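(* Let $n\ge3$ and let $F \in \mathbb{C}[x,y]_n$ be stable; write $\delta = \operatorname{dist}(z(F), j)$. Then \[ 2^{1-n} \varepsilon_F(\delta) \le \frac{\|F\|}{\theta(F)} \le 2^{-n} \binom{2n}{n} (\cosh \delta)^n. \] For $\gamma \in \mathrm{SL}(2,\mathbb{C})$ write $\gamma^{-1} \cdot z(F) = t + uj$. If \[ \frac{|t|^2 + u^2 + 1}{2u} > \cosh \varepsilon_F^{-1}\Bigl(2^{n-1} \frac{\|F\|}{\theta(F)}\Bigr), \] then $\|F \cdot \gamma\| > \|F\|$. If $F$ is squarefree, then the same conclusion $\|F\cdot\gamma\|>\|F\|$ holds under the condition \[ \frac{|t|^2 + u^2 + 1}{2u} > 2 \left(\frac{2 \|F\|}{\varepsilon(F) \theta(F)}\right)^{1/(n-2)}. \]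
   Context: For $F = a_0x^n+\dots+a_ny^n \in \mathbb{C}[x,y]_n$, $\|F\| = \sum|a_i|^2$. $\mathbb{H}_3 = \mathbb{C}\times\mathbb{R}_{>0}$ is hyperbolic $3$-space, points written $t+uj$, $j=0+1\cdot j$, $\operatorname{dist}$ hyperbolic distance. $\mathrm{SL}(2,\mathbb{C})$ acts on forms on the right by $F\cdot\begin{pmatrix}a&b\\c&d\end{pmatrix}=F(ax+by,cx+dy)$ and on $\mathbb{H}_3$ on the left by the standard isometric action. For $F = \prod_{k=1}^n (\beta_k x - \alpha_k y)$, $R(F, t+uj) = \prod_{k=1}^n \frac{|\alpha_k - \beta_k t|^2 + |\beta_k|^2 u^2}{u}$; $R(F\cdot\gamma,z)=R(F,\gamma\cdot z)$. $F$ is stable if no linear factor has multiplicity $\ge n/2$; then $z(F)$ is the unique minimizer of $R(F,\cdot)$ on $\mathbb{H}_3$ (it satisfies $z(F\cdot\gamma)=\gamma^{-1}\cdot z(F)$), and $\theta(F)=R(F,z(F))$. For stable $F$, choose $F_0$ in the $\mathrm{SL}(2,\mathbb{C})$-orbit of $F$ with $z(F_0)=j$ and set $\varepsilon_F(\delta) = \min_{\operatorname{dist}(z,j)=\delta} R(F_0,z)/R(F_0,j)$ for $\delta\ge0$ (independent of the choice of $F_0$; this is a strictly increasing bijection $\mathbb{R}_{\ge0}\to\mathbb{R}_{\ge1}$, and $\varepsilon_F^{-1}$ denotes its inverse). If $F$ is squarefree, write $F_0 = \prod_k(\beta_kx-\alpha_ky)$, let $\phi_k = \bigl(\frac{2w_k}{|w_k|^2+1},\frac{|w_k|^2-1}{|w_k|^2+1}\bigr)\in\mathbb{S}^2\subset\mathbb{C}\times\mathbb{R}$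 with $w_k=\alpha_k/\beta_k$ (and $\phi_k=(0,1)$ if $\beta_k=0$), and define \[ \varepsilon(F) = \inf_{\phi \in \mathbb{S}^2,\, 0 \le \rho < 1} \frac{\prod_{k=1}^n (1 + \langle \phi, \phi_k \rangle \rho)}{1 - \rho^2}. \] *)

(* Defs.v *)
From mathcomp Require Import all_boot all_order all_algebra.
From mathcomp Require Import complex mpoly.
From mathcomp Require Import boolp classical_sets functions reals sequences exp.

Set Implicit Arguments.
Unset Strict Implicit.
Unset Printing Implicit Defensive.
Import Order.TTheory GRing.Theory Num.Theory.
Local Open Scope classical_set_scope.
Local Open Scope ring_scope.
Local Open Scope complex_scope.

Section BinaryForms.
Variable R : realType.

(* The real-valued modulus; `|z| for z : R[i] is valued in R[i]. *)
Definition cabs (z : R[i]) : R := ComplexField.Normc.normc z.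

(* The binary forms of degree n are the elements of n.-homog; the variables
   x and y are 'X_0 and 'X_1. *)
Definition bform := {mpoly R[i][2]}.

(* beta x - alpha y *)
Definition linform (alpha beta : R[i]) : bform := beta *: 'X_0 - alpha *: 'X_1.

(* The sum of the squared moduli of the coefficients (no square root). *)
Definition fnorm (F : bform) : R := \sum_(m <- msupp F) cabs F@_m ^+ 2.

(* F (a x + b y, c x + d y) *)
Definition form_act (F : bform) (g : 'M[R[i]]_2) : bform :=
  F \mPo [tuple \sum_(j < 2) g i j *: 'X_j | i < 2].

Definition fdvd (P F : bform) : Prop := exists Q : bform, F = Q * P.

(* The zero form is excluded, being divisible by everything. *)
Definition stable (n : nat) (F : bform) : Prop :=
  forall (alpha beta : R[i]) (m : nat),
    (alpha, beta) != (0, 0) -> fdvd (linform alpha beta ^+ m) F -> (m.*2 < n)%N.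

Definition squarefree (F : bform) : Prop :=
  forall P : bform, fdvd (P ^+ 2) F -> P \is a GRing.unit.

(* The pair (t, u) stands for the point t + u j. *)
Definition H3 : set (R[i] * R) := [set z | 0 < z.2].

Definition jpt : R[i] * R := (0, 1).

Definition cosh (x : R) : R := (expR x + expR (- x)) / 2.

Definition arcosh (x : R) : R := ln (x + Num.sqrt (x ^+ 2 - 1)).

Definition hdist (z w : R[i] * R) : R :=
  arcosh ((cabs (z.1 - w.1) ^+ 2 + z.2 ^+ 2 + w.2 ^+ 2) / (2 * z.2 * w.2)).

(* The Poincare extension of the Moebius action:
   (a z + b) (c z + d)^-1 computed in the quaternions, for determinant 1. *)
Definition hact (g : 'M[R[i]]_2) (z : R[i] * R) : R[i] * R :=
  let a := g 0 0 in let b := g 0 1 in let c := g 1 0 in let d := g 1 1 in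
  let N := cabs (c * z.1 + d) ^+ 2 + cabs c ^+ 2 * z.2 ^+ 2 in
  (((a * z.1 + b) * (c * z.1 + d)^* + a * c^* * (z.2 ^+ 2)%:C) / N%:C,
   z.2 / N).

(* k |-> (alpha_k, beta_k): some factorization of F into n linear factors.
   It is unique up to reordering the factors and rescaling them by constants
   of product 1. *)
Definition factors (n : nat) (F : bform) : {ffun 'I_n -> R[i] * R[i]} :=
  xget [ffun=> (0, 0)]
    [set ab : {ffun 'I_n -> R[i] * R[i]} |
      F = \prod_(k < n) linform (ab k).1 (ab k).2].

Definition Rfun (n : nat) (F : bform) (z : R[i] * R) : R :=
  \prod_(k < n)
    ((cabs ((factors n F k).1 - (factors n F k).2 * z.1) ^+ 2
      + cabs (factors n F k).2 ^+ 2 * z.2 ^+ 2) / z.2).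

(* The unique minimizer of Rfun n F on H3. *)
Definition zpt (n : nat) (F : bform) : R[i] * R :=
  xget jpt [set z | H3 z /\
    forall w, H3 w -> w != z -> Rfun n F z < Rfun n F w].

Definition theta (n : nat) (F : bform) : R := Rfun n F (zpt n F).

Definition F0 (n : nat) (F : bform) : bform :=
  xget F [set G : bform |
    (exists2 g : 'M[R[i]]_2, \det g = 1 & G = form_act F g) /\ zpt n G = jpt].

(* The minimum (attained) of a set of reals. *)
Definition minset (A : set R) : R := xget 0 [set m | A m /\ lbound A m].

Definition epsfun (n : nat) (F : bform) (delta : R) : R :=
  minset [set Rfun n (F0 n F) z / Rfun n (F0 n F) jpt |
          z in [set z | H3 z /\ hdist z jpt = delta]].

(* The inverse of epsfun n F, restricted to [0, +oo[. *)
Definition epsfun_inv (n : nat) (F : bform) : R -> R :=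
  'pinv_(fun=> 0) [set d : R | 0 <= d] (epsfun n F).

(* The unit sphere of C x R. *)
Definition S2 : set (R[i] * R) := [set p | cabs p.1 ^+ 2 + p.2 ^+ 2 = 1].

Definition dot (p q : R[i] * R) : R := complex.Re (p.1 * q.1^*) + p.2 * q.2.

Definition sphpt (alpha beta : R[i]) : R[i] * R :=
  if beta == 0 then (0, 1) else
  let w := alpha / beta in let q := cabs w ^+ 2 in
  (2 * w / (q + 1)%:C, (q - 1) / (q + 1)).

Definition eps (n : nat) (F : bform) : R :=
  let ab := factors n (F0 n F) in
  inf [set (\prod_(k < n) (1 + dot phi (sphpt (ab k).1 (ab k).2) * rho))
           / (1 - rho ^+ 2) |
       phi in S2 & rho in [set rho : R | 0 <= rho < 1]].

End BinaryForms.

(* Main.v *)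
(* Each factor [(|alpha - beta t|^2 + |beta|^2 u^2) / u] of [R(F, z)] equals a positive constant
   times [X0 - <phi, X>], where [X0 = sqrt (1 + |X|^2)], [X] in R^3 is the hyperboloid
   coordinate of [z] and [phi] is the point of the sphere attached to the root. Stability makes
   [prod (X0 - <phi_k, X>)] proper, so it has a minimum, and strictly convex along geodesics, so
   the minimum is unique. When the minimum is at the origin, the product is supermultiplicative
   along rays, hence increasing, and the [phi_k] have barycentre 0, so that AM-GM bounds it by
   [X0 ^ n = (cosh delta) ^ n]. Since [R(F . g, j) = theta(F) R(F0, z) / R(F0, j)] for a point [z]
   at distance [dist (g^-1 z(F), j)] from [j], everything reduces to comparing the norm of a form
   with its value [R(., j)]: from below by Landau's inequality
   [prod max (|alpha|, |beta|)^2 + prod min (|alpha|, |beta|)^2 <= ||F||], from above by Parseval's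
   identity over roots of unity and AM-GM. *)

Require Import Defs.
From mathcomp Require Import all_boot all_order all_algebra.
From mathcomp Require Import complex mpoly.
From mathcomp Require Import boolp classical_sets functions reals sequences exp.
From mathcomp Require Import topology normedtype derive realfun.
From mathcomp Require Import separable cyclotomic.
From mathcomp Require Import ring lra zify.
Import Order.TTheory GRing.Theory Num.Theory.
Import numFieldNormedType.Exports.
Local Open Scope ring_scope.

Set Implicit Arguments.
Unset Strict Implicit.
Unset Printing Implicit Defensive.

Arguments cabs : simpl never.

(** * Products of height functions on hyperbolic space *)

(** Two obstacles shape the proof. First, the factorization, [zpt], [F0], [minset] and [epsfun_inv]
    are all picked by choice, so each needs a characterization before use: [prod_lin_unique] makes
    [Rfun] independent of the factorization, [zptP] and [F0P] describe the minimum point and the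
    representative, and the default value [0] of [minset] has to be ruled out or absorbed. Second,
    hyperbolic geometry is reduced to algebra: only distances to [j] occur, and their hyperbolic
    cosine is [height], so midpoints, addition along rays and the isometry property become
    identities in hyperboloid coordinates. Origin of the constants: [2 ^ (n - 1)] comes from
    replacing a product of sums max + min by the sum of the two products. The constant
    ['C(2n, n) / 2 ^ n] is the ratio of the norm to [R(., j)] for the [n]-th power of a linear form
    with coefficients of equal modulus. The exponent [n - 2] appears on putting [rho = |X| / X0], so
    that [1 - rho^2 = 1 / X0^2], in the infimum that defines [eps]. *)

Section Hyperboloid.
Variable R : realType.
Local Notation vec := (R * R * R)%type.
Implicit Types (x y f g : vec) (c h : R).

Definition dot3 x y : R := x.1.1 * y.1.1 + x.1.2 * y.1.2 + x.2 * y.2.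

Definition scale3 c x : vec := (c * x.1.1, c * x.1.2, c * x.2).

Definition height x : R := Num.sqrt (1 + dot3 x x).

Lemma dot3_ge0 x : 0 <= dot3 x x.
Proof. by rewrite /dot3; nra. Qed.

Lemma dot3_scaler c f x : dot3 f (scale3 c x) = c * dot3 f x.
Proof. by rewrite /dot3 /=; ring. Qed.

Lemma dot3_scale c x : dot3 (scale3 c x) (scale3 c x) = c ^+ 2 * dot3 x x.
Proof. by rewrite /dot3 /=; ring. Qed.

Lemma dot3_eq0 x : dot3 x x = 0 -> x = (0, 0, 0).
Proof.
case: x => -[a b] d; rewrite /dot3 /= => h.
have ha : a = 0 by nra.
have hb : b = 0 by nra.
have hd : d = 0 by nra.
by rewrite ha hb hd.
Qed.

Lemma cauchy_schwarz3 x y : dot3 x y ^+ 2 <= dot3 x x * dot3 y y.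
Proof.
rewrite -subr_ge0 [leRHS](_ : _ =
  (x.1.1 * y.1.2 - x.1.2 * y.1.1) ^+ 2 + (x.1.2 * y.2 - x.2 * y.1.2) ^+ 2
  + (x.2 * y.1.1 - x.1.1 * y.2) ^+ 2); last by rewrite /dot3; ring.
by rewrite !addr_ge0 ?sqr_ge0.
Qed.

Lemma height_sqr x : height x ^+ 2 = 1 + dot3 x x.
Proof. by rewrite sqr_sqrtr // addr_ge0 ?dot3_ge0. Qed.

Lemma height_ge1 x : 1 <= height x.
Proof.
rewrite -[leLHS]sqrtr1 /height ler_sqrt; first by rewrite lerDl dot3_ge0.
by rewrite addr_ge0 ?dot3_ge0.
Qed.

Lemma height_gt0 x : 0 < height x.
Proof. exact: lt_le_trans ltr01 (height_ge1 x). Qed.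

Lemma height_eq x h : 0 <= h -> h ^+ 2 = 1 + dot3 x x -> height x = h.
Proof. by move=> h0 e; rewrite /height -e sqrtr_sqr ger0_norm. Qed.

Lemma height0 : height (0, 0, 0) = 1.
Proof. by apply: height_eq => //; rewrite /dot3 /=; ring. Qed.

Lemma dot3_lt_height f x : dot3 f f = 1 -> `|dot3 f x| < height x.
Proof.
move=> uf; have cs := cauchy_schwarz3 f x; have hs := height_sqr x.
have h0 := height_gt0 x.
rewrite -(ltr_pXn2r (n := 2)) ?nnegrE ?(ltW h0)//.
by rewrite real_normK ?num_real// hs; rewrite uf mul1r in cs; lra.
Qed.

Lemma factor_gt0 f x : dot3 f f = 1 -> 0 < height x - dot3 f x.
Proof. by move=> /(@dot3_lt_height f x); rewrite ltr_norml; lra. Qed.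

(* [(height x - dot3 f x) * (height x + dot3 f x) >= 1] *)
Lemma factor_ge f x : dot3 f f = 1 -> (2 * height x)^-1 <= height x - dot3 f x.
Proof.
move=> uf; have := dot3_lt_height x uf; rewrite ltr_norml => /andP[h1 h2].
have cs := cauchy_schwarz3 f x; have hs := height_sqr x.
have h0 := height_gt0 x.
rewrite uf mul1r in cs; rewrite -div1r ler_pdivrMr; last by lra.
by nra.
Qed.

Lemma dot3_unit_lt1 f g : dot3 f f = 1 -> dot3 g g = 1 -> f != g -> dot3 f g < 1.
Proof.
case: f g => -[f1 f2] f3 [[g1 g2] g3]; rewrite /dot3 /= => uf ug.
apply: contraNT; rewrite -leNgt => h.
have e : (f1 - g1) ^+ 2 + (f2 - g2) ^+ 2 + (f3 - g3) ^+ 2 <= 0 by nra.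
have s1 := sqr_ge0 (f1 - g1); have s2 := sqr_ge0 (f2 - g2).
have s3 := sqr_ge0 (f3 - g3).
have /eqP : (f1 - g1) ^+ 2 = 0 by lra.
have /eqP : (f2 - g2) ^+ 2 = 0 by lra.
have /eqP : (f3 - g3) ^+ 2 = 0 by lra.
by rewrite !sqrf_eq0 !subr_eq0 => /eqP-> /eqP-> /eqP->.
Qed.

(** Cauchy-Schwarz for [f + g], whose squared norm is [2 + 2 <f, g>], gives
    [1 - <f, g> < 4 c - 2 c^2]. Combined with [separation], it forces the [phi k] that are nearly
    aligned with a given vector to coincide. *)
Lemma aligned_close f g x c h : 0 < h -> 0 <= c <= 1 -> dot3 f f = 1 -> dot3 g g = 1 ->
  dot3 x x <= h ^+ 2 -> (1 - c) * h < dot3 f x -> (1 - c) * h < dot3 g x ->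
  1 - dot3 f g < 4 * c.
Proof.
move=> h0 /andP[c0 c1] uf ug xh fx gx.
pose s : vec := (f.1.1 + g.1.1, f.1.2 + g.1.2, f.2 + g.2).
have ss : dot3 s s = 2 + 2 * dot3 f g.
  transitivity (dot3 f f + dot3 g g + 2 * dot3 f g); last by rewrite uf ug; lra.
  by rewrite /dot3 /=; ring.
have sx : dot3 s x = dot3 f x + dot3 g x by rewrite /dot3 /=; ring.
have cs := cauchy_schwarz3 s x; rewrite ss sx in cs.
have ss0 : 0 <= 2 + 2 * dot3 f g by rewrite -ss dot3_ge0.
have lo : (2 * (1 - c) * h) ^+ 2 < (dot3 f x + dot3 g x) ^+ 2.
  by rewrite ltr_pXn2r ?nnegrE //; nra.
have up : (2 + 2 * dot3 f g) * dot3 x x <= (2 + 2 * dot3 f g) * h ^+ 2.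
  exact: ler_wpM2l.
have : (4 * (1 - c) ^+ 2) * h ^+ 2 < (2 + 2 * dot3 f g) * h ^+ 2 by nra.
rewrite ltr_pM2r ?exprn_gt0//; nra.
Qed.

Section Product.
Variables (n : nat) (phi : 'I_n -> vec).
Hypothesis phi1 : forall k, dot3 (phi k) (phi k) = 1.

Definition prodH x : R := \prod_(k < n) (height x - dot3 (phi k) x).

Lemma prodH_gt0 x : 0 < prodH x.
Proof. by apply: prodr_gt0 => k _; apply: factor_gt0. Qed.

Lemma prodH0 : prodH (0, 0, 0) = 1.
Proof. by rewrite /prodH big1 // => k _; rewrite height0 /dot3 /=; ring. Qed.

Lemma separation : exists2 c, 0 < c <= 1 &
  forall k l, phi k != phi l -> 4 * c <= 1 - dot3 (phi k) (phi l).
Proof.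
pose P (kl : 'I_n * 'I_n) := phi kl.1 != phi kl.2.
pose d (kl : 'I_n * 'I_n) := (1 - dot3 (phi kl.1) (phi kl.2)) / 4.
exists (\big[Order.min/1]_(kl | P kl) d kl).
  apply/andP; split; last exact: bigmin_le_id.
  apply: (big_ind (fun c => 0 < c)) => // [a b a0 b0|kl Pkl].
    by rewrite lt_min a0.
  by rewrite divr_gt0 // subr_gt0 dot3_unit_lt1.
move=> k l kl; rewrite mulrC -ler_pdivlMr //.
exact: (@bigmin_le_cond _ _ _ 1 (k, l) P d kl).
Qed.

Definition stable_family := forall k0, (#|[set k | phi k == phi k0]|.*2 < n)%N.

(** A factor is bad when [phi k] is nearly aligned with [x]. All bad [phi k] coincide, so by
    stability fewer than half of the factors are bad. A bad one is at least of order [1 / height x],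
    a good one at least of order [height x], and after cancellation one power of the height
    survives. *)
Lemma prodH_proper : stable_family -> (0 < n)%N ->
  exists2 C, 0 < C & forall x, C * height x <= prodH x.
Proof.
move=> st n0; have [c /andP[c0 c1] sep] := separation.
exists ((c / 2) ^+ n) => [|x]; first by rewrite exprn_gt0 ?divr_gt0.
have h1 := height_ge1 x; have h0 := height_gt0 x.
pose bad := [set k | (1 - c) * height x < dot3 (phi k) x].
have badn : (#|bad|.*2 < n)%N.
  have [->|[k0 k0b]] := set_0Vmem bad; first by rewrite cards0.
  apply: leq_ltn_trans (st k0); rewrite leq_double subset_leq_card //.

  apply/fintype.subsetP => k; rewrite !inE => kb; apply: contraT => /sep.
  rewrite inE in k0b.
  have := @aligned_close (phi k) (phi k0) x c _ h0 _ (phi1 k) (phi1 k0) _ kb k0b.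
  rewrite (ltW c0) c1 height_sqr lerDr ler01 => /(_ isT isT); lra.
pose lowf k := (c / 2) * (if k \in bad then (height x)^-1 else height x).
have low k : 0 <= lowf k <= height x - dot3 (phi k) x.
  rewrite /lowf; apply/andP; split.
    by rewrite mulr_ge0 ?divr_ge0 ?(ltW c0)//; case: ifP; rewrite ?invr_ge0 ltW.
  case: ifPn => [kb|]; last by rewrite inE -leNgt => kb; nra.
  apply: le_trans (factor_ge x (phi1 k)); rewrite invfM.
  by rewrite ler_pM2r ?invr_gt0//; lra.
apply: (@le_trans _ _ (\prod_(k < n) lowf k)); last by apply: ler_prod => k _.
rewrite big_split /= prodr_const card_ord ler_pM2l ?exprn_gt0 ?divr_gt0//.
rewrite (bigID (fun k => k \in bad)) /=.
rewrite (eq_bigr (fun=> (height x)^-1)); last by move=> k ->.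
rewrite [X in _ * X](eq_bigr (fun=> height x)); last by move=> k /negbTE->.
rewrite !prodr_const exprVn mulrC ler_pdivlMr ?exprn_gt0// -exprS.
rewrite ler_weXn2l //.
have : (#|bad| + #|[predC bad]| = n)%N by rewrite cardC card_ord.
rewrite -addnn in badn.
rewrite (@eq_card _ [predC bad] [pred k | k \notin bad]) //.
move=> e.
by rewrite -(leq_add2l #|bad|) [leqRHS]e addnS.
Qed.

End Product.
End Hyperboloid.

(** * Uniqueness of the minimum and growth along rays *)

Section Minimum.
Variable R : realType.
Local Notation vec := (R * R * R)%type.
Implicit Types (x y f g u : vec) (c h v s : R).

Lemma scale3_unit x : exists2 u, dot3 u u = 1 & x = scale3 (Num.sqrt (dot3 x x)) u.
Proof.
have [x0|xN0] := eqVneq (dot3 x x) 0.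
  exists (0, 0, 1); first by rewrite /dot3 /=; ring.
  by rewrite x0 sqrtr0 (dot3_eq0 x0) /scale3 /= !mul0r.
have s0 : 0 < Num.sqrt (dot3 x x) by rewrite sqrtr_gt0 lt_neqAle eq_sym xN0 dot3_ge0.
exists (scale3 (Num.sqrt (dot3 x x))^-1 x).
  by rewrite dot3_scale exprVn sqr_sqrtr ?dot3_ge0// mulVf.
by case: x xN0 s0 => -[a b] d xN0 s0; rewrite /scale3 /= !mulVKf ?gt_eqF.
Qed.

(* The hyperbolic midpoint of the origin and [x] is [x / (2 m)] where
   [m ^ 2 = (height x + 1) / 2] (half-angle formula). *)
Lemma factor_midpoint f x (m := Num.sqrt ((height x + 1) / 2)) :
  dot3 f f = 1 ->
  (height (scale3 (2 * m)^-1 x) - dot3 f (scale3 (2 * m)^-1 x)) ^+ 2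
    <= height x - dot3 f x ?= iff (dot3 f x ^+ 2 == dot3 x x).
Proof.
move=> uf; have h1 := height_ge1 x; have hs := height_sqr x.
have m2 : m ^+ 2 = (height x + 1) / 2 by rewrite sqr_sqrtr//; lra.
have m0 : 0 < m by rewrite sqrtr_gt0; lra.
have -> : height (scale3 (2 * m)^-1 x) = m.
  apply: height_eq; first exact: ltW.
  rewrite dot3_scale exprVn exprMn m2.
  have -> : dot3 x x = height x ^+ 2 - 1 by rewrite hs; ring.
  by field; lra.
rewrite dot3_scaler.
have -> : (m - (2 * m)^-1 * dot3 f x) ^+ 2 =
    height x - dot3 f x - (dot3 x x - dot3 f x ^+ 2) / (2 * (height x + 1)).
  have -> : dot3 x x = height x ^+ 2 - 1 by rewrite hs; ring.
  have -> : height x = 2 * m ^+ 2 - 1 by rewrite m2; field.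
  by field; rewrite subrK mulf_neq0 ?expf_neq0 ?gt_eqF.
have h2 : 0 < 2 * (height x + 1) by lra.
split.
  rewrite lerBlDr lerDl divr_ge0 ?subr_ge0 ?(ltW h2)//.
  by have := cauchy_schwarz3 f x; rewrite uf mul1r.
rewrite -subr_eq0 addrAC subrr add0r oppr_eq0 mulf_eq0 invr_eq0 (gt_eqF h2) orbF.
by rewrite subr_eq0 eq_sym.
Qed.

Variables (n : nat) (phi : 'I_n -> vec).
Hypothesis phi1 : forall k, dot3 (phi k) (phi k) = 1.

(* A geodesic through the origin has two endpoints, which together carry less
   than [n] of the [phi k]. *)
Lemma stable_off_line x : stable_family phi -> (0 < n)%N -> x != (0, 0, 0) ->
  exists k, dot3 (phi k) x ^+ 2 != dot3 x x.
Proof.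
move=> st n0 x0; apply/existsP; apply: contraT.
rewrite negb_exists => /forallP al.
have {}al k : dot3 (phi k) x ^+ 2 = dot3 x x by apply/eqP; have := al k; rewrite negbK.
have q0 : dot3 x x != 0 by apply: contraNneq x0 => /dot3_eq0 ->.
pose s k := dot3 (phi k) x / dot3 x x.
have ph k : phi k = scale3 (s k) x.
  (* Equality case of Cauchy-Schwarz: with [q = <x, x>] and [t = <phi k, x>] this quantity is the
     squared norm of [q (phi k) - t x], so [phi k] is a multiple of [x]. *)
  have : dot3 x x * (dot3 x x * dot3 (phi k) (phi k) - dot3 (phi k) x ^+ 2) = 0.
    by rewrite phi1 al mulr1 subrr mulr0.
  rewrite /s; move: q0; case: (phi k) x {x0 al s} => -[a b] d [[x1 x2] x3].
  rewrite /scale3 /=; set q := dot3 (x1, x2, x3) _; set t := dot3 _ (x1, x2, x3).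
  move=> q0; rewrite [X in X = 0](_ : _ = (q * a - t * x1) ^+ 2
    + (q * b - t * x2) ^+ 2 + (q * d - t * x3) ^+ 2); last first.
    by rewrite /q /t /dot3 /=; ring.
  move=> e; have s1 := sqr_ge0 (q * a - t * x1); have s2 := sqr_ge0 (q * b - t * x2).
  have s3 := sqr_ge0 (q * d - t * x3).
  have /eqP : (q * a - t * x1) ^+ 2 = 0 by lra.
  have /eqP : (q * b - t * x2) ^+ 2 = 0 by lra.
  have /eqP : (q * d - t * x3) ^+ 2 = 0 by lra.
  rewrite !sqrf_eq0 !subr_eq0 => /eqP e3 /eqP e2 /eqP e1.
  by rewrite ![t / q * _]mulrAC -e1 -e2 -e3 ![q * _ / q]mulrAC divff // !mul1r.
pose k0 := Ordinal n0.
have sE k : (s k == s k0) || (s k == - s k0).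
  by rewrite -eqf_sqr /s !exprMn !al.
have [/existsP[k1 k1N]|] := boolP [exists k, phi k != phi k0]; last first.
  rewrite negb_exists => /forallP eqs.
  have := st k0; rewrite (_ : [set k | _] = [set: 'I_n])%SET.
    by rewrite cardsT card_ord -addnn ltnNge leq_addr.
  by apply/setP => k; rewrite !inE; have := eqs k; rewrite negbK.
have s1 : s k1 = - s k0.
  case/orP: (sE k1) => /eqP // e.
  by move: k1N; rewrite (ph k1) (ph k0) e eqxx.
have : ((#|[set k | phi k == phi k0]| + #|[set k | phi k == phi k1]|).*2 < n.*2)%N.
  by rewrite doubleD -[n.*2]addnn -addSn leq_add // ltnW.
rewrite ltn_double ltnNge -{1}(card_ord n) -cardsT.
rewrite (leq_trans _ (leq_card_setU _ _)) // subset_leq_card //.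
apply/fintype.subsetP => k _; rewrite !inE (ph k) (ph k0) (ph k1) s1.
by case/orP: (sE k) => /eqP->; rewrite eqxx ?orbT.
Qed.

(** If [prodH phi x <= 1], then [factor_midpoint], strict for at least one factor by
    [stable_off_line], makes the square of [prodH] at the midpoint [y] less than 1, against
    minimality at the origin. *)
Lemma prodH_ge1_unique : stable_family phi -> (0 < n)%N ->
  (forall x, 1 <= prodH phi x) -> forall x, x != (0, 0, 0) -> 1 < prodH phi x.
Proof.
move=> st n0 min x x0; rewrite ltNge; apply/negP => p1.
have [k0 k0N] := stable_off_line st n0 x0.
set y := scale3 (2 * Num.sqrt ((height x + 1) / 2))^-1 x.
have : prodH phi y ^+ 2 < 1.
  apply: lt_le_trans p1; rewrite /prodH -prodrXl.
  rewrite [ltLHS](bigD1 k0)//= [ltRHS](bigD1 k0)//=.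
  have [le0 eq0] := factor_midpoint x (phi1 k0).
  apply: (@lt_le_trans _ _ ((height x - dot3 (phi k0) x) *
      \prod_(i < n | i != k0) (height y - dot3 (phi i) y) ^+ 2)).
    rewrite ltr_pM2r; first by rewrite lt_neqAle eq0 k0N.
    by apply: prodr_gt0 => k _; rewrite exprn_gt0 ?factor_gt0.
  rewrite ler_pM2l ?factor_gt0// ler_prod// => k _.
  by rewrite sqr_ge0 (factor_midpoint x (phi1 k)).1.
by rewrite ltNge exprn_ege1 // min.
Qed.

(* The barycentre of the [phi k] vanishes, as is seen by testing [1 <= prodH] at the
   barycentre itself. *)
Lemma prodH_le_height : (forall x, 1 <= prodH phi x) ->
  forall x, prodH phi x <= height x ^+ n.
Proof.
move=> min; have [n0|n_gt0] := posnP n.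
  move=> x; move: phi1 min; rewrite /prodH; move: phi; rewrite n0 => ? _ _.
  by rewrite big_ord0 expr0.
have nN0 : n%:R != 0 :> R by rewrite pnatr_eq0 -lt0n.
pose b : vec := ((\sum_k (phi k).1.1) / n%:R, (\sum_k (phi k).1.2) / n%:R,
  (\sum_k (phi k).2) / n%:R).
have dotb x : (\sum_k dot3 (phi k) x) / n%:R = dot3 b x.
  rewrite /dot3 !big_split /= -!mulr_suml !mulrDl.
  by rewrite ![_ * _ / n%:R]mulrAC.
have agm x : prodH phi x <= (height x - dot3 b x) ^+ n.
  have [+ _] := @leif_AGM R 'I_n predT (fun k => height x - dot3 (phi k) x)
     (fun k _ => ltW (factor_gt0 x (phi1 k))).
  rewrite big_split sumr_const sumrN card_ord /= mulrBl dotb.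
  by rewrite -[height x *+ n]mulr_natr mulfK.
have b0 : dot3 b b = 0.
  (* With [N = dot3 b b] this reads [1 + N <= sqrt (1 + N)], which forces [N = 0]. The [n]-th root
     of [1 <= (height b - N) ^ n] may be taken because the base is a mean of positive factors. *)
  have h : 1 <= height b - dot3 b b.
    have h0 : 0 <= height b - dot3 b b.
      rewrite -dotb -[height b](mulfK nN0) -mulrBl divr_ge0 ?ler0n//.
      rewrite mulr_natr -[X in _ *+ X](card_ord n) -sumr_const -sumrB sumr_ge0//.
      by move=> k _; rewrite ltW // factor_gt0.
    rewrite leNgt; apply/negP => lt1.
    have := le_trans (min b) (agm b); rewrite leNgt exprn_ilt1 //.
    by rewrite -lt0n n_gt0.
  by have := height_sqr b; have := dot3_ge0 b; nra.
move=> x; apply: le_trans (agm x) _.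
by rewrite (dot3_eq0 b0) /dot3 /= !mul0r !addr0 subr0.
Qed.

(* Addition of collinear hyperbolic vectors: [x] is the sum of [c x] and [l x], and
   [prodH] is supermultiplicative for this addition. *)
Lemma prodH_scale_lt c x : (forall y, y != (0, 0, 0) -> 1 < prodH phi y) ->
  0 <= c < 1 -> x != (0, 0, 0) -> prodH phi (scale3 c x) < prodH phi x.
Proof.
move=> min /andP[c0 c1] x0.
(* Write [|x| = sinh b] and [|y| = sinh a]; then [l |x| = sinh (b - a)] by the subtraction formula,
   and [zh] below is the matching formula for [cosh (b - a)]. *)
set y := scale3 c x; pose l := height y - c * height x.
have hx := height_sqr x; have hy := height_sqr y.
have hx0 := height_gt0 x; have hy0 := height_gt0 y.
rewrite dot3_scale in hy.
have s0 := dot3_ge0 x.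
have l0 : 0 < l.
  rewrite subr_gt0 -(ltr_pXn2r (n := 2)) ?nnegrE ?mulr_ge0 ?(ltW hx0) ?(ltW hy0)//.
  by rewrite exprMn hx hy; nra.
have x2 : dot3 x x = height x ^+ 2 - 1 by rewrite hx; ring.
have zh : height (scale3 l x) = height x * height y - c * dot3 x x.
  apply: height_eq.
    have e : (c * dot3 x x) ^+ 2 <= (height x * height y) ^+ 2.
      by rewrite !exprMn hx hy; nra.
    by rewrite subr_ge0 -(ler_pXn2r (n := 2)) ?nnegrE ?mulr_ge0 // ltW.
  by rewrite dot3_scale /l; ring: hx hy.
have zN0 : scale3 l x != (0, 0, 0).
  apply: contra_neq x0; case: (x) => -[a b] d; rewrite /scale3 /=.
  by case=> /eqP + /eqP + /eqP; rewrite !mulf_eq0 gt_eqF //= => /eqP-> /eqP-> /eqP->.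
apply: (@lt_le_trans _ _ (prodH phi y * prodH phi (scale3 l x))).
  by rewrite ltr_pMr ?min // prodH_gt0.
rewrite /prodH -big_split /= ler_prod // => k _.
rewrite mulr_ge0 ?(ltW (factor_gt0 _ (phi1 k)))//= zh !dot3_scaler.
have cs := cauchy_schwarz3 (phi k) x; rewrite phi1 mul1r in cs.
(* The defect of supermultiplicativity of one factor is nonnegative by Cauchy-Schwarz. *)
rewrite -subr_ge0 (_ : _ - _ = c * l * (dot3 x x - dot3 (phi k) x ^+ 2)).
  by rewrite mulr_ge0 ?subr_ge0 // mulr_ge0 // ltW.
by rewrite /l; ring: hx hy.
Qed.

End Minimum.

(** * Compact sublevel sets, minima on spheres, and the bound for distinct directions *)

Section Compactness.
Variable R : realType.
Local Notation vec := (R * R * R)%type.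
Implicit Types (x y f g u : vec) (c h v s : R).
Local Open Scope classical_set_scope.

Lemma continuous_fst3 : continuous (fun x : vec => x.1.1).
Proof.
by move=> [[a b] d]; apply: (@continuous_comp _ _ _ fst fst); exact: cvg_fst.
Qed.

Lemma continuous_snd3 : continuous (fun x : vec => x.1.2).
Proof.
move=> [[a b] d]; apply: (@continuous_comp _ _ _ fst snd); [exact: cvg_fst|].
exact: cvg_snd.
Qed.

Lemma continuous_thd3 : continuous (fun x : vec => x.2).
Proof. by move=> [[a b] d]; exact: cvg_snd. Qed.

Lemma continuous_dot3 f : continuous (dot3 f).
Proof.
move=> x; rewrite /dot3; apply: cvgD; first apply: cvgD; apply: cvgMl_tmp.
- exact: continuous_fst3.
- exact: continuous_snd3.
- exact: continuous_thd3.
Qed.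

Lemma continuous_dot3_diag : continuous (fun x => dot3 x x).
Proof.
move=> x; rewrite /dot3; apply: cvgD; first apply: cvgD.
- by apply: cvgM; exact: continuous_fst3.
- by apply: cvgM; exact: continuous_snd3.
- by apply: cvgM; exact: continuous_thd3.
Qed.

Lemma continuous_height : continuous (@height R).
Proof.
move=> x; rewrite /height; apply: continuous_comp; last exact: sqrt_continuous.
by apply: cvgD; [exact: cvg_cst|exact: continuous_dot3_diag].
Qed.

Variables (n : nat) (phi : 'I_n -> vec).
Hypothesis phi1 : forall k, dot3 (phi k) (phi k) = 1.

Lemma continuous_prodH : continuous (prodH phi).
Proof.
apply: continuous_big => [|k _]; first exact: mul_continuous.
by move=> x; apply: cvgB; [exact: continuous_height|exact: continuous_dot3].
Qed.

(** [prodH_proper] bounds the height on the sublevel set by [v / C], hence every coordinate, so this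
    closed set lies in a cube. *)
Lemma compact_prodH_le v : stable_family phi -> (0 < n)%N ->
  compact [set x | prodH phi x <= v].
Proof.
move=> st n0; have [C C0 HC] := prodH_proper phi1 st n0.
pose B := v / C.
apply: (@subclosed_compact _ _ (`[- B, B] `*` `[- B, B] `*` `[- B, B])).
- have -> : [set x | prodH phi x <= v] = prodH phi @^-1` [set t | t <= v] by [].
  by apply: preimage_closed; [move=> x _; exact: continuous_prodH|exact: closed_le].
- by apply: compact_setX; [apply: compact_setX|]; exact: segment_compact.
move=> x /= xv.
have hB : height x <= B by rewrite ler_pdivlMr // mulrC (le_trans (HC x)).
have h0 := height_gt0 x; have hs := height_sqr x.
case: x xv hB h0 hs => -[a b] d _ hB h0; rewrite /dot3 /= => hs.
have bd t : t ^+ 2 <= height (a, b, d) ^+ 2 -> - B <= t <= B.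
  rewrite -ler_norml -real_normK ?num_real// ler_pXn2r ?nnegrE// ?(ltW h0)//.
  by move=> /le_trans; apply.
by split; [split|]; rewrite /= in_itv /=; apply: bd; rewrite hs; nra.
Qed.

Lemma prodH_min : stable_family phi -> (0 < n)%N ->
  exists x, forall y, prodH phi x <= prodH phi y.
Proof.
move=> st n0; pose K := [set x | prodH phi x <= 1].
have K0 : K (0, 0, 0) by rewrite /K /= prodH0.
have [] := @compact_EVT_min _ _ (prodH phi) K.
- by exists (0, 0, 0).
- exact: compact_prodH_le.
- by apply: continuous_subspaceT; exact: continuous_prodH.
move=> x /set_mem Kx xmin; exists x => y.
have [y1|/ltW y1] := leP (prodH phi y) 1; first by apply: xmin; rewrite inE.
exact: le_trans Kx y1.
Qed.

(* [s] is the largest norm reached on the compact set [prodH <= v]. *)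
Lemma prodH_sphere_min v : stable_family phi -> (0 < n)%N -> 1 <= v ->
  exists s, [/\ 0 <= s, (exists2 u, dot3 u u = 1 & prodH phi (scale3 s u) = v) &
    forall u, dot3 u u = 1 -> v <= prodH phi (scale3 s u)].
Proof.
move=> st n0 v1; pose K := [set x | prodH phi x <= v].
have [] := @compact_EVT_max _ _ (fun x => dot3 x x) K.
- by exists (0, 0, 0); rewrite /K /= prodH0.
- exact: compact_prodH_le.
- by apply: continuous_subspaceT; exact: continuous_dot3_diag.
move=> x /set_mem Kx xmax; pose s := Num.sqrt (dot3 x x).
have ss : s ^+ 2 = dot3 x x by rewrite sqr_sqrtr // dot3_ge0.
have lo u : dot3 u u = 1 -> v <= prodH phi (scale3 s u).
  (* Otherwise, by continuity, [prodH] stays below [v] slightly further out on the ray of [u], where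
     the norm exceeds its maximum [s] on [K]. *)
  move=> u1; rewrite leNgt; apply/negP => pv.
  have sc : continuous (fun t : R => scale3 t u).
    move=> t; rewrite /scale3.
    apply: (@cvg_pair _ _ _ (nbhs t) (nbhs (t * u.1.1, t * u.1.2)) (nbhs (t * u.2))).
      apply: (@cvg_pair _ _ _ (nbhs t) (nbhs (t * u.1.1)) (nbhs (t * u.1.2))).
        by apply: cvgMr_tmp; exact: cvg_id.
      by apply: cvgMr_tmp; exact: cvg_id.
    by apply: cvgMr_tmp; exact: cvg_id.
  have cont := continuous_comp (sc s) (@continuous_prodH (scale3 s u)).
  have : \forall t \near s, prodH phi (scale3 t u) < v.
    exact: (cont _ (lt_nbhsl pv)).
  move=> /nbhs_ballP[e /= e0 He].
  have : K (scale3 (s + e / 2) u).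
    apply: ltW; apply: He; rewrite /ball /= opprD addrA subrr add0r normrN.
    by rewrite gtr0_norm; lra.
  move=> /mem_set /xmax; rewrite dot3_scale u1 mulr1 -ss.
  by have := sqrtr_ge0 (dot3 x x); rewrite -/s; nra.
have [u u1 xu] := scale3_unit x.
exists s; split; [exact: sqrtr_ge0| |exact: lo].
by exists u => //; apply/eqP; rewrite eq_le lo // /s -xu [_ <= _]Kx.
Qed.

(* At most one of the [phi k] can be almost opposite to [u], and its factor is
   at least [1 - r >= (1 - r ^ 2) / 2]. *)
Lemma sphere_prod_lbound : injective phi ->
  exists2 c, 0 < c & forall u r, dot3 u u = 1 -> 0 <= r < 1 ->
    c <= (\prod_(k < n) (1 + dot3 u (phi k) * r)) / (1 - r ^+ 2).
Proof.
move=> inj; have [c /andP[c0 c1] sep] := separation phi1.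
exists (c ^+ n / 2) => [|u r u1 /andP[r0 r1]]; first by rewrite divr_gt0 ?exprn_gt0.
have r2 : 0 < 1 - r ^+ 2 by nra.
have low k : 1 - r <= 1 + dot3 u (phi k) * r.
  have := cauchy_schwarz3 u (phi k); rewrite u1 phi1 mulr1 => h.
  have : -1 <= dot3 u (phi k) by nra.
  by nra.
rewrite ler_pdivlMr //.
have cn0 m : 0 <= c ^+ m by rewrite exprn_ge0 // ltW.
have [/existsP[k0 k0b]|] := boolP [exists k, 1 + dot3 u (phi k) * r < c]; last first.
  rewrite negb_exists => /forallP good.
  apply: (@le_trans _ _ (c ^+ n)); first by have := cn0 n; nra.
  rewrite -[X in c ^+ X](card_ord n) -prodr_const ler_prod // => k _.
  by rewrite ltW //= leNgt good.
have others k : k != k0 -> c <= 1 + dot3 u (phi k) * r.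
  move=> kk0; rewrite leNgt; apply/negP => kb.
  have := sep k k0; rewrite (inj_eq inj) => /(_ kk0).
  (* [1 + <u, phi k> r] equals [1 - <phi k, x>], so [aligned_close] with [h = 1] shows that two
     factors below [c] would have the same direction. *)
  pose x := scale3 (- r) u.
  have xE l : dot3 (phi l) x = - (dot3 u (phi l) * r) by rewrite /dot3 /=; ring.
  have := @aligned_close _ (phi k) (phi k0) x c 1 ltr01.
  rewrite (ltW c0) c1 dot3_scale u1 !xE => /(_ isT (phi1 _) (phi1 _)).
  by rewrite !mulr1; do ?[move=> /(_ ltac:(nra))]; lra.
rewrite (bigD1 k0) //= [leRHS]mulrC.
have n0 : (0 < n)%N by apply: leq_ltn_trans (ltn_ord k0).
apply: (@le_trans _ _ (c ^+ n.-1 * (1 - r))).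
  apply: (@le_trans _ _ (c ^+ n.-1 * ((1 - r ^+ 2) / 2))).
    have : c ^+ n <= c ^+ n.-1.
      by rewrite -{1}(prednK n0) exprS; have := cn0 n.-1; nra.
    by nra.
  by apply: ler_wpM2l => //; nra.
apply: ler_pM => //; first by lra.
have -> : c ^+ n.-1 = \prod_(i < n | i != k0) c.
  rewrite prodr_const; congr (_ ^+ _).
  by rewrite (@eq_card _ _ (predC1 k0)) // cardC1 card_ord.
by apply: ler_prod => k kk0; rewrite ltW //= others.
Qed.

End Compactness.

(** * The norm of a product of linear forms *)

Section CoefficientNorm.
Variable R : realType.
Local Notation C := R[i].
Implicit Types (p q : {poly C}) (v : C * C) (s : seq (C * C)).
Local Open Scope complex_scope.

Lemma cabs_sqr (z : C) : cabs z ^+ 2 = complex.Re z ^+ 2 + complex.Im z ^+ 2.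
Proof. by case: z => a b; rewrite /cabs /= sqr_sqrtr // addr_ge0 ?sqr_ge0. Qed.

Lemma cabs_ge0 (z : C) : 0 <= cabs z.
Proof. by case: z => a b; rewrite /cabs /= sqrtr_ge0. Qed.

Lemma cabsM (z w : C) : cabs (z * w) = cabs z * cabs w.
Proof. exact: ComplexField.Normc.normcM. Qed.

Lemma cabs0 : cabs (0 : C) = 0.
Proof. exact: ComplexField.Normc.normc0. Qed.

Lemma cabs1 : cabs (1 : C) = 1.
Proof. exact: ComplexField.Normc.normc1. Qed.

Lemma cabs_eq0 (z : C) : (cabs z == 0) = (z == 0).
Proof.
by apply/eqP/eqP => [/ComplexField.Normc.eq0_normc //|->]; rewrite cabs0.
Qed.

Lemma cabsN (z : C) : cabs (- z) = cabs z.
Proof. by case: z => a b; rewrite /cabs /= !sqrrN. Qed.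

Lemma cabsJ (z : C) : cabs z^* = cabs z.
Proof. by case: z => a b; rewrite /cabs /= !sqrrN. Qed.

Lemma cabsR (x : R) : cabs x%:C = `|x|.
Proof. by rewrite /cabs /= expr0n addr0 sqrtr_sqr. Qed.

Lemma cabs_prod (I : Type) (r : seq I) (P : pred I) (F : I -> C) :
  cabs (\prod_(i <- r | P i) F i) = \prod_(i <- r | P i) cabs (F i).
Proof. by apply: (big_morph (@cabs R) cabsM cabs1). Qed.

Lemma cabsX (z : C) n : cabs (z ^+ n) = cabs z ^+ n.
Proof. by elim: n => [|n IH]; rewrite ?cabs1 // !exprS cabsM IH. Qed.

Lemma cabs_sqrC (z : C) : (cabs z ^+ 2)%:C = z * z^*.
Proof.
rewrite cabs_sqr; case: z => a b; apply/eqP; rewrite eq_complex /=.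
by apply/andP; split; apply/eqP; ring.
Qed.

Definition linpoly v : {poly C} := v.2 *: 'X - v.1%:P.

Definition pnorm (m : nat) p : R := \sum_(i < m) cabs p`_i ^+ 2.

Lemma coef_linpoly v p i :
  (linpoly v * p)`_i = v.2 * (if i is j.+1 then p`_j else 0) - v.1 * p`_i.
Proof.
rewrite /linpoly mulrBl coefB -scalerAl coefZ coefXM mul_polyC coefZ.
by case: i.
Qed.

Lemma size_linpoly v p m : (size p <= m)%N -> (size (linpoly v * p)%R <= m.+1)%N.
Proof.
move=> pm; apply/leq_sizeP => j mj; rewrite coef_linpoly.
have pj0 : p`_j = 0 by rewrite nth_default // (leq_trans pm) // ltnW.
case: j mj pj0 => [|j] mj ->; first by rewrite !mulr0 subr0.
by rewrite nth_default ?mulr0 ?subr0 // (leq_trans pm).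
Qed.

(** Reflects the root [v.1 / v.2] in the unit circle. On that circle the two linear polynomials have
    the same modulus, which is the source of [pnorm_linflip]. *)
Definition linflip v : C * C := (v.2^*, v.1^*).

(* The coefficients [b p_(i-1) - a p_i] and [a^* p_(i-1) - b^* p_i] of the two products
   have the same cross terms. *)
Lemma pnorm_linflip v p m : (size p <= m)%N ->
  pnorm m.+1 (linpoly (linflip v) * p) = pnorm m.+1 (linpoly v * p).
Proof.
move=> pm; apply/eqP; rewrite -subr_eq0 -sumrB; apply/eqP.
(* Since [w i] stands for [|p_(i-1)|^2], the difference of the norms telescopes. Both ends vanish:
   [w 0] by definition, the last one because [p] has size at most [m]. *)
pose w i : R := if i is j.+1 then cabs p`_j ^+ 2 else 0.
rewrite (eq_bigr (fun i : 'I_m.+1 => (cabs v.1 ^+ 2 - cabs v.2 ^+ 2) * (w i - w i.+1))).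
  rewrite -mulr_sumr -(big_mkord xpredT (fun i => w i - w i.+1)) /=.
  under eq_bigr => i _ do rewrite -opprB.
  rewrite sumrN telescope_sumr // /w nth_default // cabs0 expr0n.
  by rewrite subr0 oppr0 mulr0.
move=> i _; rewrite (cabs_sqr v.1) (cabs_sqr v.2) !coef_linpoly; move: (nat_of_ord i) => {}i.
case: i => [|i] /=; case: v => -[a1 a2] [b1 b2] /=.
  rewrite !mulr0 !sub0r !cabsN !cabs_sqr; case: (p`_0) => c d /=; ring.
by rewrite !cabs_sqr; case: (p`_i) (p`_i.+1) => c d [e f] /=; ring.
Qed.

Lemma size_mul_prod_linpoly s p m : (size p <= m)%N ->
  (size (p * \prod_(v <- s) linpoly v)%R <= size s + m)%N.
Proof.
elim: s p m => [|v s IH] p m pm; first by rewrite big_nil mulr1.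
rewrite big_cons /= mulrA [p * _]mulrC addSnnS.
by apply: IH; exact: size_linpoly.
Qed.

Lemma size_prod_linpoly s : (size (\prod_(v <- s) linpoly v)%R <= (size s).+1)%N.
Proof.
by rewrite -[\prod_(v <- s) _]mul1r -addn1 size_mul_prod_linpoly ?size_poly1.
Qed.

Lemma coef_top_prod_linpoly s :
  (\prod_(v <- s) linpoly v)`_(size s) = \prod_(v <- s) v.2.
Proof.
elim: s => [|v s IH]; first by rewrite !big_nil coef1.
rewrite !big_cons /= coef_linpoly IH [X in _ - _ * X]nth_default ?mulr0 ?subr0//.
exact: size_prod_linpoly.
Qed.

Lemma coef0_prod_linpoly s :
  (\prod_(v <- s) linpoly v)`_0 = \prod_(v <- s) (- v.1).
Proof.
elim: s => [|v s IH]; first by rewrite !big_nil coef1.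
by rewrite !big_cons /= coef_linpoly IH mulr0 sub0r mulNr.
Qed.

(** The factors are flipped one at a time; the cofactor [p] absorbs those already treated. *)
Lemma pnorm_prod_flip s (f : C * C -> bool) p m : (size p <= m)%N ->
  pnorm (size s + m) (p * \prod_(v <- s) linpoly (if f v then linflip v else v)) =
  pnorm (size s + m) (p * \prod_(v <- s) linpoly v).
Proof.
elim: s p m => [|v s IH] p m pm; first by rewrite !big_nil.
rewrite !big_cons /=; transitivity (pnorm (size s + m.+1)
    (linpoly v * p * \prod_(v <- s) linpoly (if f v then linflip v else v))).
  case: (f v); last by rewrite addnS mulrA [p * _]mulrC.
  rewrite addnS mulrCA -mulrA pnorm_linflip //.
  rewrite -(size_map (fun v => if f v then linflip v else v) s).
  rewrite -(big_map (fun v => if f v then linflip v else v) xpredT linpoly).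
  exact: size_mul_prod_linpoly.
rewrite IH; last exact: size_linpoly.
by rewrite addnS mulrA [p * _]mulrC.
Qed.

(** Induction on [(M + m)(P + p) <= 2 (M P + m p)], whose defect is [(M - m)(P - p)]. The first
    factor costs nothing, hence the exponent one less than the size. *)
Lemma prodrD_le (T : Type) (r : seq T) (M m : T -> R) :
  (forall i, 0 <= m i <= M i) -> (0 < size r)%N ->
  \prod_(i <- r) (M i + m i) <=
  2 ^+ (size r).-1 * (\prod_(i <- r) M i + \prod_(i <- r) m i).
Proof.
move=> mM; case: r => // i0 r _; elim: r i0 => [|i r IH] i0.
  by rewrite !big_seq1 expr0 mul1r.
rewrite big_cons ![\prod_(i <- i0 :: _) _]big_cons; move: (IH i) => /=.
set P := \prod_(i <- _) M _; set p := \prod_(i <- _) m _ => h.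
have /andP[m0 m0M] := mM i0.
have p0 : 0 <= p by apply: prodr_ge0 => k; have /andP[] := mM k.
have pP : p <= P by apply: ler_prod => k _; apply: mM.
have e0 : 0 <= 2 ^+ size r :> R by rewrite exprn_ge0.
apply: (@le_trans _ _ ((M i0 + m i0) * (2 ^+ size r * (P + p)))).
  by apply: ler_wpM2l; [lra|exact: h].
rewrite exprS -subr_ge0 (_ : _ - _ = 2 ^+ size r * ((M i0 - m i0) * (P - p))); last by ring.
by rewrite !mulr_ge0 ?subr_ge0.
Qed.

(* Landau's inequality in the sharp form [prod max^2 + prod min^2 <= ||F||]: flipping
   factors so that the larger coefficient of each leads does not change the norm. *)
Lemma pnorm_prod_ge s : (0 < size s)%N ->
  \prod_(v <- s) (cabs v.1 ^+ 2 + cabs v.2 ^+ 2) <=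
  2 ^+ (size s).-1 * pnorm (size s).+1 (\prod_(v <- s) linpoly v).
Proof.
move=> s0; pose f v := cabs v.2 < cabs v.1.
pose g v := if f v then linflip v else v.
have gE v : cabs (g v).1 <= cabs (g v).2 /\
    cabs v.1 ^+ 2 + cabs v.2 ^+ 2 = cabs (g v).2 ^+ 2 + cabs (g v).1 ^+ 2.
  rewrite /g /f; case: ltP => [h|h]; last by rewrite addrC.
  by rewrite /linflip /= !cabsJ ltW.
rewrite (eq_bigr (fun v => cabs (g v).2 ^+ 2 + cabs (g v).1 ^+ 2)); last first.
  by move=> v _; have [] := gE v.
have gle v : 0 <= cabs (g v).1 ^+ 2 <= cabs (g v).2 ^+ 2.
  by rewrite sqr_ge0 /= ler_pXn2r ?nnegrE ?cabs_ge0//; have [] := gE v.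
apply: le_trans (prodrD_le gle s0) _.
rewrite ler_wpM2l ?exprn_ge0// -[\prod_(v <- s) linpoly v]mul1r -[(size s).+1]addn1.
rewrite -(@pnorm_prod_flip s f) ?size_poly1// mul1r addn1.
rewrite -(big_map g xpredT linpoly) -(big_map g xpredT (fun v => cabs v.2 ^+ 2)).
rewrite -(big_map g xpredT (fun v => cabs v.1 ^+ 2)) -(size_map g) /= in s0 *.
move: (map g s) s0 => {s f g gE gle} s s0.
(* Only the two extreme coefficients are kept: after flipping, the squared modulus of the leading
   one is the product of the maxima, and that of the constant one the product of the minima. They
   are distinct since [s] is nonempty. *)
rewrite /pnorm big_ord_recr /= coef_top_prod_linpoly [leRHS]addrC.
rewrite cabs_prod -prodrXl lerD2l -(prednK s0) big_ord_recl /= coef0_prod_linpoly.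
rewrite cabs_prod -prodrXl [X in _ <= X + _](eq_bigr (fun v => cabs v.1 ^+ 2)); last first.
  by move=> v _; rewrite cabsN.
by rewrite lerDl sumr_ge0 // => i _; exact: sqr_ge0.
Qed.

Lemma coef_exp_le (p q : {poly R}) : (forall i, 0 <= p`_i <= q`_i) ->
  forall n i, 0 <= (p ^+ n)`_i <= (q ^+ n)`_i.
Proof.
move=> pq; elim=> [|n IH] i; first by rewrite !expr0 coef1 ler0n lexx.
rewrite !exprS !coefM sumr_ge0 /= => [|j _]; last first.
  by rewrite mulr_ge0 //; [have /andP[] := pq j|have /andP[] := IH (i - j)%N].
apply: ler_sum => j _.
have /andP[? ?] := pq j; have /andP[? ?] := IH (i - j)%N.
exact: ler_pM.
Qed.

Lemma coef_lin_exp (A : comNzRingType) (x y : A) m i :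
  ((x *: 'X + y%:P) ^+ m)`_i = 'C(m, i)%:R * x ^+ i * y ^+ (m - i).
Proof.
rewrite addrC exprDn coef_sum.
transitivity (\sum_(k < m.+1)
    if (k == i :> nat) then 'C(m, i)%:R * x ^+ i * y ^+ (m - i) else 0).
  apply: eq_bigr => k _; rewrite exprZn -polyC_exp mul_polyC coefMn !coefZ coefXn.
  rewrite eq_sym; case: eqP => [->|_]; last by rewrite !mulr0 mul0rn.
  by rewrite mulr1 -mulr_natl; ring.
have [ni|ni] := ltnP m i.
  rewrite bin_small // !mul0r big1 // => k _; rewrite ifN //.
  by rewrite neq_ltn (leq_trans (ltn_ord k)).
rewrite (bigD1 (Ordinal (ni : (i < m.+1)%N))) //= eqxx big1 ?addr0 // => k.
by rewrite -val_eqE /= => /negbTE ->.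
Qed.

(* The sum is the middle coefficient of [((aX + b)(bX + a)) ^ n], and coefficientwise
   [(aX + b)(bX + a) <= (a^2 + b^2) / 2 * (X + 1) ^ 2]. *)
Lemma sum_bin_sqr_le n (a b : R) : 0 <= a -> 0 <= b ->
  \sum_(i < n.+1) ('C(n, i)%:R * a ^+ i * b ^+ (n - i)) ^+ 2 <=
  (2 ^+ n)^-1 * ('C(n.*2, n))%:R * (a ^+ 2 + b ^+ 2) ^+ n.
Proof.
move=> a0 b0.
pose lin (a b : R) : {poly R} := a *: 'X + b%:P.
have coef_lin x y m i := coef_lin_exp x y m i.
have -> : \sum_(i < n.+1) ('C(n, i)%:R * a ^+ i * b ^+ (n - i)) ^+ 2 =
    ((lin a b * lin b a) ^+ n)`_n.
  rewrite exprMn coefM; apply: eq_bigr => i _; rewrite !coef_lin.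
  rewrite bin_sub -1?ltnS // subKn -1?ltnS //; ring.
apply: (@le_trans _ _ ((((a ^+ 2 + b ^+ 2) / 2) *: lin 1 1 ^+ 2) ^+ n)`_n).
  suff H i : 0 <= (lin a b * lin b a)`_i <= (((a ^+ 2 + b ^+ 2) / 2) *: lin 1 1 ^+ 2)`_i.
    by have /andP[] := coef_exp_le H n n.
  have e : lin a b * lin b a = (a * b) *: 'X ^+ 2 + (a ^+ 2 + b ^+ 2) *: 'X + (a * b)%:P.
    rewrite /lin -!mul_polyC !polyCD !polyCM; ring.
  have e1 : lin 1 1 ^+ 2 = 'X ^+ 2 + 2 *: 'X + 1.
    by rewrite /lin -!mul_polyC !polyCMn; ring.
  rewrite e e1 coefZ !coefD !coefZ coefC coef1 coefX coefXn.
  have ab := mulr_ge0 a0 b0; have d := sqr_ge0 (a - b).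
  case: i => [|[|[|i]]] /=; rewrite ?mulr1 ?mulr0 ?add0r ?addr0 ?mulr0 ?lexx //.
  1-3: by apply/andP; split; nra.
rewrite exprZn -exprM coefZ mul2n.
rewrite coef_lin !expr1n !mulr1.
by rewrite exprMn exprVn; lra.
Qed.

Lemma pnorm_linpoly_exp_le n v :
  pnorm n.+1 (linpoly v ^+ n) <=
  (2 ^+ n)^-1 * ('C(n.*2, n))%:R * (cabs v.1 ^+ 2 + cabs v.2 ^+ 2) ^+ n.
Proof.
rewrite [cabs v.1 ^+ 2 + _]addrC.
apply: le_trans (sum_bin_sqr_le n (cabs_ge0 v.2) (cabs_ge0 v.1)).
apply: ler_sum => i _; rewrite /linpoly -polyCN coef_lin_exp !cabsM !cabsX cabsN.
suff -> : cabs ('C(n, i)%:R : C) = 'C(n, i)%:R by [].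
by rewrite -(rmorph_nat (real_complex R)) cabsR ger0_norm.
Qed.

Lemma prim_root_complex N : (0 < N)%N -> exists z : C, N.-primitive_root z.
Proof.
pose p : {poly C} := 'X^N - 1; have [r Dp] := closed_field_poly_normal p.
move=> N0; rewrite (monicP _) ?monicXnsubC // scale1r in Dp.
have rn1 : all N.-unity_root r by apply/allP => z; rewrite -root_prod_XsubC -Dp.
have sz_r : (N < (size r).+1)%N by rewrite -(size_prod_XsubC r id) -Dp size_XnsubC.
have [|z _ pz] := hasP (cyclic.has_prim_root N0 rn1 _ sz_r); last by exists z.
by rewrite -separable_prod_XsubC -Dp separable_Xn_sub_1 // pnatr_eq0 -lt0n.
Qed.

Lemma parseval N (z : C) p : N.-primitive_root z -> (size p <= N)%N ->
  \sum_(j < N) cabs p.[z ^+ j] ^+ 2 = N%:R * pnorm N p.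
Proof.
move=> pz sp; have N0 := prim_order_gt0 pz; have zN := prim_expr_order pz.
have z1 : cabs z = 1.
  apply/eqP; rewrite -(eqrXn2 N0) ?cabs_ge0 ?ler01// expr1n -cabsX zN cabs1 //.
have zJ : z * z^* = 1 by rewrite -cabs_sqrC z1 expr1n.
apply: (@complexI R); rewrite rmorphM rmorph_nat !rmorph_sum /=.
transitivity (\sum_(j < N) \sum_(i < N) \sum_(k < N)
    p`_i * (p`_k)^* * (z ^+ i * z^* ^+ k) ^+ j).
  apply: eq_bigr => j _; rewrite cabs_sqrC (horner_coef_wide _ sp) rmorph_sum mulr_suml.
  apply: eq_bigr => i _; rewrite mulr_sumr; apply: eq_bigr => k _ /=.
  rewrite rmorphM rmorphXn /= rmorphXn /= exprMn -!exprM ![(_ * j)%N]mulnC; ring.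
rewrite exchange_big mulr_sumr; apply: eq_bigr => i _ /=.
rewrite exchange_big (bigD1 i) //= [X in _ + X]big1 ?addr0 => [|k ki].
  rewrite -mulr_sumr -exprMn zJ expr1n -cabs_sqrC mulrC; congr (_ * _).
  by rewrite (eq_bigr (fun=> 1)) ?sumr_const ?card_ord // => j _; rewrite expr1n.
(* Off the diagonal, [w] is an [N]-th root of unity other than 1, so the sum of its powers
   vanishes. *)
rewrite -mulr_sumr; set w := z ^+ i * _.
have wN : w ^+ N = 1.
  rewrite /w exprMn -!exprM ![(_ * N)%N]mulnC !exprM zN expr1n mul1r.
  by rewrite -rmorphXn /= zN rmorph1 expr1n.
have w1 : w != 1.
  apply: contra ki => /eqP w1.
  have : z ^+ i == z ^+ k.
    by rewrite -[z ^+ k]mul1r -w1 /w -mulrA -exprMn [_^* * z]mulrC zJ expr1n mulr1.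
  by rewrite (eq_prim_root_expr pz) !modn_small // eq_sym.
have /eqP := subrX1 w N; rewrite wN subrr eq_sym mulf_eq0 subr_eq0 (negbTE w1) /=.
by move=> /eqP ->; rewrite mulr0.
Qed.

Lemma prod_le_mean_exp n (x : 'I_n -> R) : (0 < n)%N -> (forall k, 0 <= x k) ->
  \prod_k x k <= (\sum_k x k ^+ n) / n%:R.
Proof.
move=> n0 x0; have [+ _] := @leif_AGM R 'I_n predT (fun k => x k ^+ n)
  (fun k _ => exprn_ge0 n (x0 k)).
rewrite card_ord prodrXl ler_pXn2r ?nnegrE ?prodr_ge0 //.
by rewrite divr_ge0 ?ler0n // sumr_ge0 // => k _; rewrite exprn_ge0.
Qed.

(* By Parseval over the roots of unity and the AM-GM inequality, the normalized product
   of [n] factors is dominated by the average of the [n]-th powers of the factors. *)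
Lemma pnorm_prod_le n (v : 'I_n -> C * C) : (0 < n)%N ->
  pnorm n.+1 (\prod_k linpoly (v k)) <=
  (2 ^+ n)^-1 * ('C(n.*2, n))%:R * \prod_k (cabs (v k).1 ^+ 2 + cabs (v k).2 ^+ 2).
Proof.
move=> n0; pose e k := cabs (v k).1 ^+ 2 + cabs (v k).2 ^+ 2.
set K := _ * _%:R; have K0 : 0 <= K by rewrite mulr_ge0 ?invr_ge0 ?exprn_ge0.
have e_ge0 k : 0 <= e k by rewrite addr_ge0 ?sqr_ge0.
(* A zero factor cannot be normalized, but it makes the whole product zero. *)
have [/existsP[k0 /eqP ek0]|] := boolP [exists k, e k == 0].
  rewrite (bigD1 k0) //=.
  have /eqP := ek0; rewrite paddr_eq0 ?sqr_ge0 // !sqrf_eq0 !cabs_eq0.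
  move=> /andP[/eqP v1 /eqP v2]; rewrite /linpoly v1 v2 scale0r subr0 mul0r.
  rewrite /pnorm big1 => [|i _]; last by rewrite coef0 cabs0 expr0n.
  by apply: mulr_ge0 => //; apply: prodr_ge0 => k _; exact: e_ge0.
rewrite negb_exists => /forallP eN0.
have e0 k : 0 < e k by rewrite lt_neqAle eq_sym eN0 e_ge0.
(* [n + 1] nodes suffice for Parseval, as the products involved have degree at most [n]. *)
have [z pz] := prim_root_complex (ltn0Sn n).
have sz w : (size (linpoly w) <= 2)%N.
  by rewrite -[linpoly w]mulr1 size_linpoly // size_poly1.
have szp : (size (\prod_k linpoly (v k))%R <= n.+1)%N.
  have := size_prod_linpoly [seq v k | k <- enum 'I_n].
  by rewrite big_map big_enum size_map size_enum_ord.
have szX w : (size (linpoly w ^+ n)%R <= n.+1)%N.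
  have := size_prod_linpoly (nseq n w).
  by rewrite big_nseq size_nseq iter_mulr_1.
have N0 : 0 < n.+1%:R :> R by rewrite ltr0n.
rewrite -(ler_pM2l N0) -(parseval pz szp).
pose x k (j : 'I_n.+1) := cabs (linpoly (v k)).[z ^+ j] ^+ 2 / e k.
have x0 k j : 0 <= x k j by rewrite divr_ge0 ?sqr_ge0.
have xX k : \sum_j x k j ^+ n <= n.+1%:R * K.
  rewrite (eq_bigr (fun j : 'I_n.+1 => cabs (linpoly (v k) ^+ n).[z ^+ j] ^+ 2 / e k ^+ n)).
    rewrite -mulr_suml (parseval pz (szX _)) -mulrA ler_pM2l //.
    by rewrite ler_pdivrMr ?exprn_gt0 // pnorm_linpoly_exp_le.
  by move=> j _; rewrite /x expr_div_n horner_exp cabsX -!exprM mulnC.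
(* AM-GM is applied at each node separately; exchanging the sums then leaves, for each [k], the norm
   of an [n]-th power. *)
apply: (@le_trans _ _ (\prod_k e k * \sum_j (\sum_k x k j ^+ n) / n%:R)).
  rewrite mulr_sumr; apply: ler_sum => j _.
  rewrite horner_prod cabs_prod -prodrXl.
  rewrite (eq_bigr (fun k => e k * x k j)); last by move=> k _; rewrite mulrC divfK // gt_eqF.
  rewrite big_split ler_wpM2l ?prodr_ge0 //; exact: prod_le_mean_exp.
rewrite mulrA [leRHS]mulrC ler_wpM2l ?prodr_ge0 // -mulr_suml ler_pdivrMr ?ltr0n //.
rewrite exchange_big /= mulr_natr -[X in _ *+ X](card_ord n) -sumr_const.
by apply: ler_sum => k _; exact: xX.
Qed.

End CoefficientNorm.

(** * Binary forms as products of linear forms *)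

Section BinaryFormFactors.
Variable R : realType.
Local Notation C := R[i].
Implicit Types (p q : {poly C}) (v w : C * C) (s : seq (C * C)) (F : bform R).
Local Open Scope complex_scope.

Definition lin v : bform R := linform v.1 v.2.

Definition mon2 (n i : nat) : 'X_{1..2} := (U_(0%R) *+ i + U_(1%R) *+ (n - i))%MM.

Definition homogenize n p : bform R := \sum_(i < n.+1) p`_i *: 'X_[mon2 n i].

Lemma mon2_0 n i : mon2 n i 0%R = i.
Proof. by rewrite mnmDE !mulmnE !mnm1E /= mul1n mul0n addn0. Qed.

Lemma mdeg_mon2 n i : (i <= n)%N -> mdeg (mon2 n i) = n.
Proof. by move=> ni; rewrite mdegD !mdegMn !mdeg1 !mul1n subnKC. Qed.

Lemma mon2_mdeg (m : 'X_{1..2}) : mon2 (mdeg m) (m 0%R) = m.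
Proof.
apply/mnmP => j; rewrite mnmDE !mulmnE !mnm1E mdegE !big_ord_recl big_ord0 addn0 addKn.
case: j => -[|[|//]] jlt /=; rewrite mul1n mul0n ?addn0 ?add0n; congr (m _); exact: val_inj.
Qed.

Lemma mcoeff_homogenize n p (m : 'X_{1..2}) :
  (homogenize n p)@_m = if mdeg m == n then p`_(m 0%R) else 0.
Proof.
rewrite /homogenize raddf_sum /=.
under eq_bigr => i _ do rewrite mcoeffZ mcoeffX.
case: eqP => [<-|mn]; last first.
  rewrite big1 // => i _; case: eqP => [e|_]; last by rewrite mulr0.
  by case: mn; rewrite -e mdeg_mon2 // -ltnS.
have lt : (m 0%R < (mdeg m).+1)%N.
  by rewrite ltnS mdegE !big_ord_recl big_ord0 addn0 leq_addr.
rewrite (bigD1 (Ordinal lt)) //= mon2_mdeg eqxx mulr1 big1 ?addr0 // => i.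
rewrite -val_eqE /= => im; case: eqP => [e|_]; last by rewrite mulr0.
by have h := mon2_0 (mdeg m) i; rewrite e in h; rewrite h eqxx in im.
Qed.

Lemma fnorm_homogenize n p : fnorm (homogenize n p) = pnorm n.+1 p.
Proof.
set F := homogenize n p.
have FE i : (i <= n)%N -> F@_(mon2 n i) = p`_i.
  by move=> ni; rewrite mcoeff_homogenize mdeg_mon2 // eqxx mon2_0.
pose L := [seq mon2 n (i : 'I_n.+1) | i <- enum 'I_n.+1].
have uL : uniq L.
  rewrite map_inj_uniq ?enum_uniq // => i j /(congr1 (fun m : 'X_{1..2} => m 0%R)).
  by rewrite !mon2_0 => /val_inj.
have -> : pnorm n.+1 p = \sum_(m <- L) cabs F@_m ^+ 2.
  rewrite big_map big_enum; apply: eq_bigr => i _ /=.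
  by rewrite FE // -ltnS.
rewrite (bigID (mem (msupp F))) /= [X in _ + X]big1 ?addr0; last first.
  by move=> m; rewrite -mcoeff_eq0 => /eqP ->; rewrite cabs0 expr0n.
rewrite -big_filter /fnorm; apply: perm_big; apply: uniq_perm.
- exact: msupp_uniq.
- exact: filter_uniq.
move=> m; rewrite mem_filter /=; case: (boolP (m \in msupp F)) => //= mF.
apply/esym/mapP; move: mF; rewrite mcoeff_msupp mcoeff_homogenize.
case: (mdeg m =P n) => [mn _|]; last by rewrite eqxx.
have lt : (m 0%R < n.+1)%N.
  by rewrite ltnS -mn mdegE !big_ord_recl big_ord0 addn0 leq_addr.
by exists (Ordinal lt); rewrite ?mem_enum //= -mn mon2_mdeg.
Qed.

Lemma homogenize_dhomog n F : F \is n.-homog ->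
  F = homogenize n (\poly_(i < n.+1) F@_(mon2 n i)).
Proof.
move=> hF; apply/mpolyP => m; rewrite mcoeff_homogenize coef_poly.
case: eqP => [mn|/eqP mn]; last by rewrite (dhomog_nemf_coeff hF).
rewrite ltnS -mn mdegE !big_ord_recl big_ord0 addn0 leq_addr.
by rewrite -[X in F@_X]mon2_mdeg mdegE !big_ord_recl big_ord0 addn0.
Qed.

Lemma homogenize_linpoly n v p : (size p <= n.+1)%N ->
  homogenize n.+1 (linpoly v * p) = lin v * homogenize n p.
Proof.
move=> sp; rewrite [LHS]/homogenize.
under eq_bigr => i _ do rewrite coef_linpoly scalerBl.
rewrite /lin /linform mulrBl -!scalerAl /homogenize !mulr_sumr.
rewrite sumrB; congr (_ - _).
  rewrite big_ord_recl /= mulr0 scale0r add0r scaler_sumr; apply: eq_bigr => i _.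
  rewrite -scalerAr -mpolyXD scalerA /=; congr (_ *: 'X_[_]).
  by apply/mnmP => j; rewrite !mnmDE !mulmnE /bump /= add1n mulnS subSS addnA.
rewrite big_ord_recr /= [X in _ * X]nth_default // mulr0 scale0r addr0 scaler_sumr.
apply: eq_bigr => i _.
rewrite -scalerAr -mpolyXD scalerA /=; congr (_ *: 'X_[_]).
apply/mnmP => j; rewrite !mnmDE !mulmnE /= subSn ?mulnS 1?addnCA //.
by rewrite -ltnS.
Qed.

Lemma homogenize_prod_linpoly s :
  homogenize (size s) (\prod_(v <- s) linpoly v) = \prod_(v <- s) lin v.
Proof.
elim: s => [|v s IH].
  rewrite !big_nil /homogenize big_ord_recl big_ord0 addr0 coef1 scale1r.
  by rewrite (_ : mon2 _ _ = 0%MM) ?mpolyX0 //; apply/eqP; rewrite -mdeg_eq0 mdeg_mon2.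
by rewrite !big_cons homogenize_linpoly ?IH // size_prod_linpoly.
Qed.

Lemma fnorm_prod_lin n (v : 'I_n -> C * C) :
  fnorm (\prod_k lin (v k)) = pnorm n.+1 (\prod_k linpoly (v k)).
Proof.
have := homogenize_prod_linpoly [seq v k | k <- enum 'I_n].
rewrite big_map big_enum big_map big_enum /= size_map size_enum_ord => <-.
exact: fnorm_homogenize.
Qed.

Lemma fnorm_ge n (v : 'I_n -> C * C) : (0 < n)%N ->
  \prod_k (cabs (v k).1 ^+ 2 + cabs (v k).2 ^+ 2) <=
  2 ^+ n.-1 * fnorm (\prod_k lin (v k)).
Proof.
move=> n0; have := @pnorm_prod_ge _ [seq v k | k <- enum 'I_n].
by rewrite big_map big_enum big_map big_enum /= size_map size_enum_ord fnorm_prod_lin; apply.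
Qed.

Lemma fnorm_le n (v : 'I_n -> C * C) : (0 < n)%N ->
  fnorm (\prod_k lin (v k)) <= (2 ^+ n)^-1 * ('C(n.*2, n))%:R *
    \prod_k (cabs (v k).1 ^+ 2 + cabs (v k).2 ^+ 2).
Proof. by move=> n0; rewrite fnorm_prod_lin; exact: pnorm_prod_le. Qed.

Lemma fnorm_ge0 F : 0 <= fnorm F.
Proof. by apply: sumr_ge0 => m _; exact: sqr_ge0. Qed.

Lemma linpoly_scale (c : C) v : linpoly (c * v.1, c * v.2) = c *: linpoly v.
Proof. by rewrite /linpoly /= scalerBr scalerA -(mul_polyC c v.1%:P) -polyCM. Qed.

Lemma lin_scale (c : C) v : lin (c * v.1, c * v.2) = c *: lin v.
Proof. by rewrite /lin /linform /= scalerBr !scalerA. Qed.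

(** The dehomogenized polynomial splits over the complex numbers. Its missing degree is filled by
    pairs [(-1, 0)], the form [y] with root at infinity, and the leading coefficient is absorbed by
    the first factor, which exists since [n > 0]. *)
Lemma dhomog_factor n F : F \is n.-homog -> F != 0 -> (0 < n)%N ->
  exists v : 'I_n -> C * C, F = \prod_k lin (v k).
Proof.
move=> hF F0 n0; set p := \poly_(i < n.+1) F@_(mon2 n i).
have Fp : F = homogenize n p := homogenize_dhomog hF.
have sp : (size p <= n.+1)%N := size_poly _ _.
have p0 : p != 0.
  apply: contra_neq F0; rewrite Fp => ->.
  by rewrite /homogenize big1 // => i _; rewrite coef0 scale0r.
have [r Dp] := closed_field_poly_normal p.
have szr : (size r <= n)%N.
  by move: sp; rewrite Dp size_scale ?lead_coef_eq0 // size_prod_XsubC.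
pose s := [seq (z, 1) | z <- r] ++ nseq (n - size r) (-1, 0) : seq (C * C).
have ps : \prod_(v <- s) linpoly v = \prod_(z <- r) ('X - z%:P).
  rewrite big_cat big_nseq /= big_map (_ : linpoly (-1, 0) = 1).
    rewrite iter_mulr_1 expr1n mulr1; apply: eq_bigr => z _.
    by rewrite /linpoly scale1r.
  by rewrite /linpoly /= scale0r sub0r polyCN opprK.
have ss : size s = n by rewrite size_cat size_map size_nseq subnKC.
case: s ss ps => [|v s] ss ps; first by rewrite -ss in n0.
pose s' := (lead_coef p * v.1, lead_coef p * v.2) :: s.
have ss' : size s' = n by [].
have Fs : F = \prod_(v <- s') lin v.
  rewrite -homogenize_prod_linpoly ss' Fp big_cons linpoly_scale -scalerAl.
  by congr homogenize; rewrite {1}Dp -ps big_cons.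
exists (fun k : 'I_n => nth (0, 0) s' k).
by rewrite Fs (big_nth (0, 0)) ss' big_mkord.
Qed.

Lemma factors_prod n (v : 'I_n -> C * C) (F := \prod_k lin (v k)) :
  F = \prod_k lin (factors n F k).
Proof.
pose S : set {ffun 'I_n -> C * C} := [set ab : {ffun 'I_n -> C * C} |
  F = \prod_(k < n) linform (ab k).1 (ab k).2]%classic.
apply: (@xgetPex _ [ffun=> (0, 0)] S).
by exists [ffun k => v k]; apply: eq_bigr => k _; rewrite ffunE.
Qed.

Lemma lin_eq0 v : (lin v == 0) = (v == (0, 0)).
Proof.
apply/eqP/eqP => [|->]; last by rewrite /lin /linform /= !scale0r subr0.
move=> e; have H (x : 'I_2 -> C) : v.2 * x 0 - v.1 * x 1 = 0.
  by rewrite -(meval0 x) -e mevalB !mevalZ !mevalXU.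
have := H (fun i => (i == 0)%:R); have := H (fun i => (i == 1)%:R).
rewrite /= !mulr1 !mulr0 subr0 sub0r => /eqP; rewrite oppr_eq0 => /eqP h1 h2.
by rewrite [v]surjective_pairing h1 h2.
Qed.

Lemma prod_lin_neq0 n (v : 'I_n -> C * C) k :
  \prod_k lin (v k) != 0 -> v k != (0, 0).
Proof. by move=> /prodf_neq0 /(_ k isT); rewrite lin_eq0. Qed.

Definition proportional v w := v.1 * w.2 == v.2 * w.1.

Lemma proportionalP v w : v != (0, 0) -> proportional v w ->
  exists c : C, w = (c * v.1, c * v.2).
Proof.
case: v w => a b [x y] v0; rewrite /proportional /= => /eqP e.
have [a0|a0] := eqVneq a 0.
  have b0 : b != 0 by apply: contra_neq v0 => ->; rewrite a0.
  exists (y / b); rewrite divfK // a0 mulr0.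
  by move: e; rewrite a0 mul0r => /esym/eqP; rewrite mulf_eq0 (negbTE b0) => /eqP ->.
by exists (x / a); rewrite divfK // mulrAC [x * b]mulrC -e mulrAC divff // mul1r.
Qed.

(* Any [chi] that scales like a squared modulus has the same product over all factorizations
   into linear forms, since these agree up to permutation and scaling. *)
Lemma prod_lin_unique (chi : C * C -> R) s1 s2 (c : C) :
  (forall (c : C) v, chi (c * v.1, c * v.2) = cabs c ^+ 2 * chi v) ->
  size s1 = size s2 -> \prod_(v <- s1) lin v = c *: \prod_(v <- s2) lin v ->
  \prod_(v <- s1) lin v != 0 ->
  \prod_(v <- s1) chi v = cabs c ^+ 2 * \prod_(v <- s2) chi v.
Proof.
move=> chiZ; elim: s1 s2 c => [|v s1 IH] s2 c.
  move=> /esym/size0nil ->; rewrite !big_nil => e _.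
  suff -> : c = 1 by rewrite cabs1 expr1n mulr1.
  by move: e => /(congr1 (mcoeff 0)); rewrite mcoeffZ mcoeff1 eqxx mulr1 => <-.
move=> ss e; rewrite big_cons mulf_eq0 negb_or => /andP[v0 s1N0].
have c0 : c != 0.
  apply: contra_neq v0 => c0; move: e; rewrite c0 scale0r big_cons => /eqP.
  by rewrite mulf_eq0 (negbTE s1N0) orbF => /eqP.
have : has (proportional v) s2.
  (* [lin v] vanishes at the point [v], so some factor of the other product vanishes there as
     well. *)
  move: e => /(congr1 (meval (fun i => if i == 0 then v.1 else v.2))).
  rewrite big_cons mevalM {1}/lin /linform mevalB !mevalZ !mevalXU /= mulrC.
  rewrite [v.1 * _]mulrC subrr mulr0 => /esym/eqP.
  rewrite mulf_eq0 (negbTE c0) /= rmorph_prod /= prodf_seq_eq0.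
  apply: sub_has => w /=; rewrite mevalB !mevalZ !mevalXU /= subr_eq0 /proportional.
  by rewrite mulrC [w.1 * _]mulrC.
move=> /hasP[w ws2 vw].
have [|a wE] := proportionalP _ vw; first by rewrite -lin_eq0.
have lw : lin w = a *: lin v by rewrite [in LHS]wE lin_scale.
have cw : chi w = cabs a ^+ 2 * chi v by rewrite [in LHS]wE chiZ.
have ps2 := perm_to_rem ws2.
have e' : \prod_(v <- s1) lin v = (c * a) *: \prod_(v <- rem w s2) lin v.
  apply: (mulfI v0); move: e; rewrite big_cons (perm_big _ ps2) big_cons => ->.
  by rewrite lw /= -scalerAl scalerA -scalerAr.
rewrite big_cons (IH (rem w s2) (c * a)) //; last first.
  by rewrite size_rem // -ss.
by rewrite (perm_big _ ps2) big_cons /= cw cabsM; ring.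
Qed.

End BinaryFormFactors.

(** * The action of SL(2, C) *)

Section Action.
Variable R : realType.
Local Notation C := R[i].
Implicit Types (v w : C * C) (z : C * R) (g h : 'M[C]_2) (F : bform R).
Local Open Scope complex_scope.

(* The positive definite Hermitian form whose product over the factors is [Rfun]. *)
Definition hform z v : R :=
  (cabs (v.1 - v.2 * z.1) ^+ 2 + cabs v.2 ^+ 2 * z.2 ^+ 2) / z.2.

(** For determinant 1 this multiplies the column [(alpha, beta)] by the inverse of [g]: substituting
    [g] into a form moves its roots by the inverse. *)
Definition pair_act g v : C * C :=
  (v.1 * g 1 1 - v.2 * g 0 1, v.2 * g 0 0 - v.1 * g 1 0).

Lemma hform_scale z (c : C) v : hform z (c * v.1, c * v.2) = cabs c ^+ 2 * hform z v.
Proof. by rewrite /hform /= -mulrA -mulrBr !cabsM; ring. Qed.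

Lemma hform_j v : hform (jpt R) v = cabs v.1 ^+ 2 + cabs v.2 ^+ 2.
Proof. by rewrite /hform /jpt /= mulr0 subr0 expr1n mulr1 divr1. Qed.

(** Frees [Rfun] from the factorization chosen by [factors], so that the one transported by
    [pair_act] can be used. *)
Lemma Rfun_prod n (v : 'I_n -> C * C) z : \prod_k lin (v k) != 0 ->
  Rfun n (\prod_k lin (v k)) z = \prod_k hform z (v k).
Proof.
set F := \prod_k _ => F0; have e : F = \prod_k lin (factors n F k) := factors_prod v.
have := @prod_lin_unique R (hform z) [seq factors n F k | k <- enum 'I_n]
  [seq v k | k <- enum 'I_n] 1 (@hform_scale z).
rewrite !size_map scale1r cabs1 expr1n mul1r.
do 4 rewrite big_map big_enum /=.
by rewrite -e; apply.
Qed.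

Lemma form_act_lin g v : form_act (lin v) g = lin (pair_act g v).
Proof.
rewrite /form_act /lin /linform comp_mpolyB !comp_mpolyZ !comp_mpolyXU.
rewrite -!tnth_nth !tnth_mktuple !big_ord_recl !big_ord0 !addr0 /=.
rewrite (_ : lift ord0 ord0 = 1); last exact: val_inj.
rewrite (_ : ord0 = 0 :> 'I_2); last exact: val_inj.
by rewrite !scalerDr !scalerBl !scalerA opprD addrACA opprB.
Qed.

Lemma form_act_prod n g (v : 'I_n -> C * C) :
  form_act (\prod_k lin (v k)) g = \prod_k lin (pair_act g (v k)).
Proof.
rewrite /form_act rmorph_prod; apply: eq_bigr => k _.
exact: form_act_lin.
Qed.

Lemma form_actM g F G : form_act (F * G) g = form_act F g * form_act G g.
Proof. by rewrite /form_act rmorphM. Qed.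

Lemma form_actX g F m : form_act (F ^+ m) g = form_act F g ^+ m.
Proof. by rewrite /form_act rmorphXn. Qed.

Lemma det_mx2 g : \det g = g 0 0 * g 1 1 - g 0 1 * g 1 0.
Proof.
rewrite (expand_det_row _ 0) !big_ord_recl big_ord0 addr0 /cofactor !det_mx11 !mxE /=.
rewrite (_ : lift ord0 ord0 = 1); last exact: val_inj.
rewrite expr0 expr1 mul1r mulN1r mulrN.
by congr (_ * g _ _ - _ * g _ _); apply: val_inj.
Qed.

Lemma pair_act_mul g h v : pair_act h (pair_act g v) = pair_act (g *m h) v.
Proof.
rewrite /pair_act !mxE !big_ord_recl !big_ord0 !addr0 /=.
rewrite (_ : lift ord0 ord0 = 1); last exact: val_inj.
by congr pair; ring.
Qed.

Lemma pair_act1 v : pair_act 1%:M v = v.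
Proof. by case: v => a b; rewrite /pair_act !mxE /=; congr pair; ring. Qed.

Lemma denom_gt0 g z : \det g = 1 -> 0 < z.2 ->
  0 < cabs (g 1 0 * z.1 + g 1 1) ^+ 2 + cabs (g 1 0) ^+ 2 * z.2 ^+ 2.
Proof.
rewrite det_mx2 => dg u0; have u2 : 0 < z.2 ^+ 2 by rewrite exprn_gt0.
have s1 := sqr_ge0 (cabs (g 1 0 * z.1 + g 1 1)).
have s2 := mulr_ge0 (sqr_ge0 (cabs (g 1 0))) (ltW u2).
rewrite lt_neqAle addr_ge0 // andbT eq_sym paddr_eq0 // sqrf_eq0 mulf_eq0 (gt_eqF u2) orbF.
rewrite sqrf_eq0 !cabs_eq0.
apply/negP => /andP[/eqP e /eqP c0]; move: e dg; rewrite c0 mul0r add0r => ->.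
by move=> /eqP; rewrite !mulr0 subr0 eq_sym oner_eq0.
Qed.

Lemma hact_gt0 g z : \det g = 1 -> 0 < z.2 -> 0 < (hact g z).2.
Proof. by move=> dg z0; rewrite divr_gt0 // denom_gt0. Qed.

(** Lagrange's identity in C^2 for the vectors [(q, u c)] and [(m, u l)]. *)
Lemma lagrange_identity (q m c l : C) (u : R) :
  cabs (q^* * m + c^* * (u ^+ 2)%:C * l) ^+ 2 + u ^+ 2 * cabs (c * m - q * l) ^+ 2 =
  (cabs q ^+ 2 + cabs c ^+ 2 * u ^+ 2) * (cabs m ^+ 2 + cabs l ^+ 2 * u ^+ 2).
Proof.
by rewrite !cabs_sqr; case: q m c l => q1 q2 [m1 m2] [c1 c2] [l1 l2] /=; ring.
Qed.

Lemma hform_act g z v : \det g = 1 -> 0 < z.2 ->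
  hform z (pair_act g v) = hform (hact g z) v.
Proof.
move=> dg u0; have N0 := denom_gt0 dg u0; rewrite det_mx2 in dg.
rewrite /hform /hact /pair_act /=.
move: dg N0; set a := g 0 0; set b := g 0 1; set c := g 1 0; set d := g 1 1.
case: z u0 => t u /= u0; case: v => al be /= dg.
set N := cabs _ ^+ 2 + _ => N0.
pose m := al * (c * t + d) - be * (a * t + b).
pose l := be * a - al * c.
have -> : al * d - be * b - l * t = m by rewrite /m /l; ring.
set S := _ / N%:C.
have NC : N%:C != 0 by rewrite (fmorph_eq0 (real_complex R)) gt_eqF.
have mE : N%:C * (al - be * S) = (c * t + d)^* * m + c^* * (u ^+ 2)%:C * - l.
  rewrite mulrBr mulrCA [N%:C * S]mulrC /S divfK //.
  rewrite /N rmorphD /= cabs_sqrC rmorphM /= cabs_sqrC rmorphD rmorphM /= /m /l; ring.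
have lE : be = c * m - (c * t + d) * - l.
  by rewrite -[LHS]mulr1 -dg /m /l; ring.
have key := lagrange_identity (c * t + d) m c (- l) u.
rewrite -mE -lE cabsM cabsR gtr0_norm // cabsN -/N in key.
have -> : cabs (al - be * S) ^+ 2 + cabs be ^+ 2 * (u / N) ^+ 2 =
    ((N * cabs (al - be * S)) ^+ 2 + u ^+ 2 * cabs be ^+ 2) / N ^+ 2.
  by field; rewrite gt_eqF.
by rewrite key; field; rewrite !gt_eqF.
Qed.

(** A point can be tested through its Hermitian form. With [hform_act], this reduces the composition
    law and the transitivity of [hact] to the linear action on pairs. *)
Lemma hform_inj (z w : C * R) : 0 < z.2 -> 0 < w.2 ->
  (forall v, hform z v = hform w v) -> z = w.
Proof.
case: z w => t u [s r] /= u0 r0 H.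
have ur : u = r.
  have := H (1, 0); rewrite /hform /= !mul0r !subr0 cabs0 cabs1 expr0n expr1n /= !mul0r.
  by rewrite !addr0 !mul1r => /invr_inj.
move: s r0 H; rewrite -ur => s _ H; congr pair.
have h a b : cabs (a - b * t) ^+ 2 = cabs (a - b * s) ^+ 2.
  by have /(divIf (negbT (gt_eqF u0))) /addIr := H (a, b).
(* The distances to 0, 1 and i determine a complex number. *)
have := h 0 1; have := h 1 1; have := h 'i%C 1; rewrite !cabs_sqr !mul1r.
case: t s {H h} => t1 t2 [s1 s2] /= => h1 h2 h3.
have -> : t1 = s1 by nra.
by have -> : t2 = s2 by nra.
Qed.

Lemma hact_mul g h z : \det g = 1 -> \det h = 1 -> 0 < z.2 ->
  hact (g *m h) z = hact g (hact h z).
Proof.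
move=> dg dh z0; have dgh : \det (g *m h) = 1 by rewrite det_mulmx dg dh mulr1.
have hz0 := hact_gt0 dh z0.
apply: hform_inj => [||v]; rewrite ?hact_gt0 //.
by rewrite -!hform_act // pair_act_mul.
Qed.

Lemma hact1 z : 0 < z.2 -> hact 1%:M z = z.
Proof.
move=> z0; apply: hform_inj => [||v]; rewrite ?hact_gt0 ?det1 //.
by rewrite -hform_act ?det1 // pair_act1.
Qed.

Lemma mulVmx1 g : \det g = 1 -> invmx g *m g = 1%:M.
Proof. by move=> dg; rewrite mulVmx // unitmxE dg unitr1. Qed.

Lemma mulmxV1 g : \det g = 1 -> g *m invmx g = 1%:M.
Proof. by move=> dg; rewrite mulmxV // unitmxE dg unitr1. Qed.

Lemma det_invmx1 g : \det g = 1 -> \det (invmx g) = 1.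
Proof. by move=> dg; rewrite det_inv dg invr1. Qed.

Lemma hactK g z : \det g = 1 -> 0 < z.2 -> hact (invmx g) (hact g z) = z.
Proof. by move=> dg z0; rewrite -hact_mul ?det_invmx1 // mulVmx1 // hact1. Qed.

Lemma hactVK g z : \det g = 1 -> 0 < z.2 -> hact g (hact (invmx g) z) = z.
Proof. by move=> dg z0; rewrite -hact_mul ?det_invmx1 // mulmxV1 // hact1. Qed.

Lemma hact_transitive z : 0 < z.2 -> exists2 g, \det g = 1 & hact g (jpt R) = z.
Proof.
case: z => t u /= u0; pose r := Num.sqrt u.
have r0 : 0 < r by rewrite sqrtr_gt0.
have ru : r ^+ 2 = u by rewrite sqr_sqrtr // ltW.
pose g : 'M[C]_2 := \matrix_(i, j) if i == 0 then (if j == 0 then r%:C else t / r%:C)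
  else (if j == 0 then 0 else (r^-1)%:C).
have rC : r%:C != 0 by rewrite (fmorph_eq0 (real_complex R)) gt_eqF.
have dg : \det g = 1.
  by rewrite det_mx2 !mxE /= mulr0 subr0 -rmorphM /= divff ?gt_eqF // rmorph1.
exists g => //; apply: hform_inj => [||v] //; first exact: hact_gt0.
rewrite -hform_act // hform_j /hform /pair_act !mxE /=.
have -> : v.1 * (r^-1)%:C - v.2 * (t / r%:C) = (v.1 - v.2 * t) * (r^-1)%:C.
  by rewrite fmorphV; ring.
by rewrite mulr0 subr0 !cabsM !cabsR !gtr0_norm ?invr_gt0 // -ru; field; rewrite gt_eqF.
Qed.

Lemma invmx2 g : \det g = 1 ->
  [/\ invmx g 0 0 = g 1 1, invmx g 0 1 = - g 0 1,
      invmx g 1 0 = - g 1 0 & invmx g 1 1 = g 0 0].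
Proof.
move=> dg; pose h : 'M[C]_2 := \matrix_(i, j)
  if i == 0 then (if j == 0 then g 1 1 else - g 0 1)
  else (if j == 0 then - g 1 0 else g 0 0).
suff -> : invmx g = h by rewrite !mxE.
suff hg : h *m g = 1%:M by rewrite -[LHS]mul1mx -hg -mulmxA mulmxV1 ?mulmx1.
rewrite det_mx2 in dg; have e1 : lift ord0 ord0 = 1 :> 'I_2 by exact: val_inj.
apply/matrixP => i j; rewrite !mxE !big_ord_recl big_ord0 addr0 !mxE e1 /=.
rewrite (_ : ord0 = 0 :> 'I_2); last exact: val_inj.
have j01 (k : 'I_2) : k = 0 \/ k = 1.
  by case: k => -[|[|//]] klt; [left|right]; exact: val_inj.
by case: (j01 i) => ->; case: (j01 j) => ->; rewrite /= -?dg; ring.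
Qed.

(** Both sides are the sum of the squared moduli of the four entries, which inversion permutes up to
    sign. By [height_hform], this says that [g j] and [g^-1 j] are equally far from [j]. *)
Lemma hact_invmx_j g : \det g = 1 ->
  hform (hact (invmx g) (jpt R)) (1, 0) + hform (hact (invmx g) (jpt R)) (0, 1) =
  hform (hact g (jpt R)) (1, 0) + hform (hact g (jpt R)) (0, 1).
Proof.
move=> dg; rewrite -!hform_act ?det_invmx1 //= !hform_j /pair_act /=.
have [-> -> -> ->] := invmx2 dg.
by rewrite !mul0r !mul1r !subr0 !sub0r !cabsN; ring.
Qed.

End Action.

(** * From the upper half space to hyperboloid coordinates *)

Section HyperboloidModel.
Variable R : realType.
Local Notation C := R[i].
Local Notation vec := (R * R * R)%type.
Implicit Types (v w : C * C) (z : C * R) (x : vec).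
Local Open Scope complex_scope.

Definition vec_of z : vec :=
  (complex.Re z.1 / z.2, complex.Im z.1 / z.2, (cabs z.1 ^+ 2 + z.2 ^+ 2 - 1) / (2 * z.2)).

Definition point_of x : C * R :=
  ((x.1.1 / (height x - x.2)) +i* (x.1.2 / (height x - x.2)), (height x - x.2)^-1).

Definition weight v : R := cabs v.1 ^+ 2 + cabs v.2 ^+ 2.

(** Inverse stereographic projection of the root [v.1 / v.2] in homogeneous form, which covers the
    root at infinity too; [vec_of_pair_sphpt] identifies it with [sphpt]. *)
Definition direction v : vec :=
  (2 * complex.Re (v.1 * v.2^*) / weight v, 2 * complex.Im (v.1 * v.2^*) / weight v,
   (cabs v.1 ^+ 2 - cabs v.2 ^+ 2) / weight v).

Lemma height_vec_of z : 0 < z.2 ->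
  height (vec_of z) = (cabs z.1 ^+ 2 + z.2 ^+ 2 + 1) / (2 * z.2).
Proof.
case: z => -[a b] u /= u0; apply: height_eq.
  by rewrite divr_ge0 ?addr_ge0 ?sqr_ge0 ?mulr_ge0 ?ler0n ?ler01 // ltW.
by rewrite /dot3 /vec_of !cabs_sqr /=; field; rewrite gt_eqF.
Qed.

Lemma height_hform z : 0 < z.2 ->
  height (vec_of z) = (hform z (1, 0) + hform z (0, 1)) / 2.
Proof.
move=> z0; rewrite height_vec_of // /hform /= !mul0r !mul1r subr0 sub0r cabs0 cabs1 cabsN.
by field; rewrite gt_eqF.
Qed.

Lemma weight_gt0 v : v != (0, 0) -> 0 < weight v.
Proof.
move=> v0; rewrite lt_neqAle addr_ge0 ?sqr_ge0 // andbT eq_sym.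
apply: contraNneq v0 => /eqP; rewrite paddr_eq0 ?sqr_ge0 // !sqrf_eq0 !cabs_eq0.
by case: v => a b /= /andP[/eqP -> /eqP ->].
Qed.

Lemma dot3_direction v : v != (0, 0) -> dot3 (direction v) (direction v) = 1.
Proof.
move=> /weight_gt0; rewrite /direction /dot3 /=; set N := weight v => N0.
have NE : N = cabs v.1 ^+ 2 + cabs v.2 ^+ 2 by [].
rewrite !cabs_sqr in NE *; clearbody N.
case: v NE => -[a b] [c d] /= NE.
by rewrite NE in N0 *; field; rewrite gt_eqF.
Qed.

Lemma hformE z v : 0 < z.2 -> v != (0, 0) ->
  hform z v = weight v * (height (vec_of z) - dot3 (direction v) (vec_of z)).
Proof.
move=> z0 v0; have N0 := weight_gt0 v0; rewrite height_vec_of //.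
rewrite mulrBr /direction /dot3; set N := weight v in N0 *; rewrite /vec_of /=.
have -> : forall a b c d e f : R,
  N * (a / N * d + b / N * e + c / N * f) = a * d + b * e + c * f.
  by move=> *; field; rewrite gt_eqF.
rewrite /N /weight /hform !cabs_sqr; clear N N0.
case: z z0 v v0 => -[t1 t2] u /= u0 [[a b] [c d]] _ /=.
by field; rewrite gt_eqF.
Qed.

(** The direction determines [|v.2|^2] and the product of [v.1] with the conjugate of [v.2], both
    divided by [weight v]; these fix the line of [v]. *)
Lemma direction_eq v w : v != (0, 0) -> w != (0, 0) ->
  direction v = direction w -> proportional v w.
Proof.
move=> /weight_gt0 + /weight_gt0; rewrite /direction /proportional.
set N := weight v; set M := weight w => N0 M0 [e1 e2 e3].
have NE : N = cabs v.1 ^+ 2 + cabs v.2 ^+ 2 by [].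
have ME : M = cabs w.1 ^+ 2 + cabs w.2 ^+ 2 by [].
have cross (a b : R) : a / N = b / M -> a * M = b * N.
  by move=> /eqP; rewrite eqr_div ?lt0r_neq0 // => /eqP.
have e4 : M * cabs v.2 ^+ 2 = N * cabs w.2 ^+ 2.
  by move: (cross _ _ e3); rewrite NE ME; lra.
have e5 : M%:C * (v.1 * v.2^*) = N%:C * (w.1 * w.2^*).
  move: (cross _ _ e1) (cross _ _ e2); case: (v.1 * _) (w.1 * _) => a b [c d] /= h1 h2.
  by apply/eqP; rewrite eq_complex /=; apply/andP; split; apply/eqP; lra.
have [v2|v2] := eqVneq v.2 0.
  move: e4; rewrite v2 cabs0 expr0n mulr0 => /esym/eqP.
  by rewrite mulf_eq0 (gt_eqF N0) sqrf_eq0 cabs_eq0 /= => /eqP ->; rewrite mulr0 mul0r.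
have v2J : M%:C * v.2^* != 0.
  apply: mulf_neq0; first by rewrite (fmorph_eq0 (real_complex R)) gt_eqF.
  by rewrite -cabs_eq0 cabsJ cabs_eq0.
apply/eqP/(mulfI v2J).
move: e4 => /(congr1 (real_complex R)); rewrite [LHS]rmorphM [RHS]rmorphM /= !cabs_sqrC => e4.
transitivity (M%:C * (v.1 * v.2^*) * w.2); first by ring.
by rewrite e5; transitivity (N%:C * (w.2 * w.2^*) * w.1); [ring|rewrite -e4; ring].
Qed.

Lemma point_of_gt0 x : 0 < (point_of x).2.
Proof.
rewrite /= invr_gt0.
have := @factor_gt0 _ (0, 0, 1) x; rewrite /dot3 /= !mul0r !add0r !mul1r; apply.
by [].
Qed.

Lemma vec_ofK x : vec_of (point_of x) = x.
Proof.
have := point_of_gt0 x; rewrite /= invr_gt0 => h0; have hs := height_sqr x.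
case: x h0 hs => -[a b] c; set h := height _; rewrite /dot3 /= => h0 hs.
rewrite /vec_of /= cabs_sqr /= -/h !invrK !divfK ?gt_eqF //; congr (_, _, _).
have -> : (a / (h - c)) ^+ 2 + (b / (h - c)) ^+ 2 = (h ^+ 2 - 1 - c ^+ 2) / (h - c) ^+ 2.
  by rewrite hs; field; rewrite gt_eqF.
by field; rewrite gt_eqF.
Qed.

Lemma vec_of_inj z (w : C * R) : 0 < z.2 -> 0 < w.2 -> vec_of z = vec_of w -> z = w.
Proof.
move=> z0 w0 e; apply: hform_inj => // v.
have [->|v0] := eqVneq v (0, 0); last by rewrite !hformE // e.
by rewrite /hform /= !mul0r !subr0 cabs0 expr0n /= !mul0r addr0 !mul0r.
Qed.

Lemma vec_of_j : vec_of (jpt R) = (0, 0, 0).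
Proof. by rewrite /vec_of /= cabs0 expr0n expr1n /= add0r subrr !mul0r. Qed.

End HyperboloidModel.

(** * Minimum points of stable forms *)

Section MinimumPoint.
Variables (R : realType) (n : nat).
Hypothesis n_gt0 : (0 < n)%N.
Local Notation C := R[i].
Local Notation vec := (R * R * R)%type.
Implicit Types (v : C * C) (z w : C * R) (g : 'M[C]_2) (F : bform R).

Definition split_form F := F != 0 /\ F = \prod_k lin (factors n F k).

Definition root_dir F (k : 'I_n) : vec := direction (factors n F k).

Lemma split_form_prod (v : 'I_n -> C * C) :
  \prod_k lin (v k) != 0 -> split_form (\prod_k lin (v k)).
Proof.
by move=> F0; split=> //; exact: factors_prod.
Qed.

Lemma stable_neq0 F : stable n F -> F != 0.
Proof.
move=> st; apply: contraT => /negPn/eqP F0.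
have := st 1 0 n; rewrite F0 -addnn => H.
suff : (n + n < n)%N by rewrite ltnNge leq_addr.
apply: H; last by exists 0; rewrite mul0r.
by rewrite xpair_eqE oner_eq0.
Qed.

Lemma split_form_stable F : F \is n.-homog -> stable n F -> split_form F.
Proof.
move=> hF /stable_neq0 F0; have [v e] := dhomog_factor hF F0 n_gt0.
by rewrite e in F0 *; exact: split_form_prod.
Qed.

Section SplitForm.
Variable F : bform R.
Hypothesis sF : split_form F.

Lemma factors_neq0 k : factors n F k != (0, 0).
Proof. by have [F0 e] := sF; apply: (@prod_lin_neq0 _ _ (factors n F)); rewrite -e. Qed.

Lemma dot3_root_dir k : dot3 (root_dir F k) (root_dir F k) = 1.
Proof. by rewrite dot3_direction // factors_neq0. Qed.

Lemma Rfun_hform z : Rfun n F z = \prod_k hform z (factors n F k).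
Proof. by []. Qed.

Lemma Rfun_prodH z : 0 < z.2 ->
  Rfun n F z = \prod_k weight (factors n F k) * prodH (root_dir F) (vec_of z).
Proof.
move=> z0; rewrite Rfun_hform -big_split; apply: eq_bigr => k _.
by rewrite hformE // factors_neq0.
Qed.

Lemma prod_weight_gt0 : 0 < \prod_k weight (factors n F k).
Proof. by apply: prodr_gt0 => k _; rewrite weight_gt0 // factors_neq0. Qed.

Lemma Rfun_gt0 z : 0 < z.2 -> 0 < Rfun n F z.
Proof.
move=> z0; rewrite Rfun_prodH // mulr_gt0 ?prod_weight_gt0 ?prodH_gt0 //.
exact: dot3_root_dir.
Qed.

Lemma form_act_split g : form_act F g = \prod_k lin (pair_act g (factors n F k)).
Proof. by have [_ {1}->] := sF; exact: form_act_prod. Qed.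

Lemma form_actK g : \det g = 1 -> form_act (form_act F g) (invmx g) = F.
Proof.
move=> dg; rewrite form_act_split form_act_prod [in RHS](sF.2).
by apply: eq_bigr => k _; rewrite pair_act_mul mulmxV1 // pair_act1.
Qed.

Lemma pair_act_neq0 g v : \det g = 1 -> v != (0, 0) -> pair_act g v != (0, 0).
Proof.
move=> dg; apply: contra_neq => e.
rewrite -[v]pair_act1 -(mulmxV1 dg) -pair_act_mul e.
by rewrite /pair_act /= !mul0r subrr.
Qed.

Lemma form_act_neq0 g : \det g = 1 -> form_act F g != 0.
Proof.
move=> dg; rewrite form_act_split; apply/prodf_neq0 => k _.
by rewrite lin_eq0 pair_act_neq0 // factors_neq0.
Qed.

Lemma split_form_act g : \det g = 1 -> split_form (form_act F g).
Proof.
by move=> dg; have := form_act_neq0 dg; rewrite form_act_split; exact: split_form_prod.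
Qed.

Lemma Rfun_act g z : \det g = 1 -> 0 < z.2 ->
  Rfun n (form_act F g) z = Rfun n F (hact g z).
Proof.
move=> dg z0; rewrite form_act_split Rfun_prod -?form_act_split ?form_act_neq0 //.
by apply: eq_bigr => k _; rewrite hform_act.
Qed.

Lemma fdvd_act g P : \det g = 1 -> fdvd P (form_act F g) -> fdvd (form_act P (invmx g)) F.
Proof.
by move=> dg [Q e]; exists (form_act Q (invmx g)); rewrite -form_actM -e form_actK.
Qed.

Lemma stable_act g : \det g = 1 -> stable n F -> stable n (form_act F g).
Proof.
move=> dg st al be m ab0 /(fdvd_act dg).
rewrite form_actX [form_act _ _](form_act_lin _ (al, be)); apply: st.
by rewrite -surjective_pairing pair_act_neq0 // det_invmx1.
Qed.

(** Turns coinciding roots into divisibility by a power, the language of both [stable] and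
    [squarefree]. *)
Lemma fdvd_parallel (A : {set 'I_n}) k0 :
  (forall k, k \in A -> proportional (factors n F k0) (factors n F k)) ->
  fdvd (lin (factors n F k0) ^+ #|A|) F.
Proof.
move=> pA; have [_ e] := sF.
have /boolp.choice[c cE] : forall k, exists c : C, k \in A ->
    lin (factors n F k) = c *: lin (factors n F k0).
  move=> k; have [kA|] := boolP (k \in A); last by exists 0.
  have [c cE] := proportionalP (factors_neq0 k0) (pA k kA).
  by exists c => _; rewrite [in LHS]cE lin_scale.
exists ((\prod_(k in A) c k) *: \prod_(k | k \notin A) lin (factors n F k)).
rewrite [LHS]e (bigID (mem A)) /= mulrC -scalerAl scalerAr; congr (_ * _).
by rewrite (eq_bigr _ cE) scaler_prod prodr_const.
Qed.

Lemma stable_root_dir : stable n F -> stable_family (root_dir F).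
Proof.
move=> st k0; set A := [set k | _]%SET.
have := st (factors n F k0).1 (factors n F k0).2 #|A|.
rewrite -surjective_pairing factors_neq0; apply => //.
apply: fdvd_parallel => k; rewrite inE => /eqP e.
by apply: direction_eq; rewrite ?factors_neq0.
Qed.

Lemma Rfun_min_exists : stable n F ->
  exists2 z, 0 < z.2 & forall w, 0 < w.2 -> Rfun n F z <= Rfun n F w.
Proof.
move=> st; have [x xmin] := prodH_min dot3_root_dir (stable_root_dir st) n_gt0.
exists (point_of x); first exact: point_of_gt0.
move=> w w0; rewrite !Rfun_prodH ?point_of_gt0 // vec_ofK.
by rewrite ler_pM2l ?prod_weight_gt0.
Qed.

Lemma Rfun_j_min_prodH : (forall w, 0 < w.2 -> Rfun n F (jpt R) <= Rfun n F w) ->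
  forall x, 1 <= prodH (root_dir F) x.
Proof.
move=> min x; have := min _ (point_of_gt0 x).
rewrite !Rfun_prodH ?point_of_gt0 ?ltr01 // vec_ofK vec_of_j prodH0 //.
by rewrite ler_pM2l ?prod_weight_gt0.
Qed.

Lemma Rfun_j_min_strict : stable n F ->
  (forall w, 0 < w.2 -> Rfun n F (jpt R) <= Rfun n F w) ->
  forall w, 0 < w.2 -> w != jpt R -> Rfun n F (jpt R) < Rfun n F w.
Proof.
move=> st min w w0 wj; rewrite !Rfun_prodH ?ltr01 // ltr_pM2l ?prod_weight_gt0 //.
rewrite vec_of_j prodH0; apply: prodH_ge1_unique => //.
- exact: dot3_root_dir.
- exact: stable_root_dir.
- exact: Rfun_j_min_prodH.
apply: contra_neq wj; rewrite -vec_of_j => /vec_of_inj; apply => //; exact: ltr01.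
Qed.

End SplitForm.

Section StableForm.
Variable F : bform R.
Hypotheses (sF : split_form F) (st : stable n F).

Lemma zptP : 0 < (zpt n F).2 /\
  forall w, 0 < w.2 -> w != zpt n F -> Rfun n F (zpt n F) < Rfun n F w.
Proof.
have [z z0 zmin] := Rfun_min_exists sF st.
apply: (@xgetPex _ (jpt R) [set z | H3 z /\
    forall w, H3 w -> w != z -> Rfun n F z < Rfun n F w]%classic).
exists z; split=> // w w0 wz.
(* Strictness is known only for a minimum at [j], so the minimizer is moved there by [g]. *)
have [g dg gz] := hact_transitive z0.
have j0 : 0 < (jpt R).2 by exact: ltr01.
have h0 : 0 < (hact (invmx g) w).2 by rewrite hact_gt0 // det_invmx1.
have := @Rfun_j_min_strict (form_act F g) (split_form_act sF dg) (stable_act sF dg st).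
have RE u : 0 < u.2 -> Rfun n (form_act F g) u = Rfun n F (hact g u).
  by move=> u0; rewrite Rfun_act.
rewrite !RE // gz => /(_ _ (hact (invmx g) w) h0).
rewrite RE // hactVK //; apply.
  by move=> u u0; rewrite RE // zmin // hact_gt0.
by apply: contra_neq wz => e; rewrite -gz -e hactVK.
Qed.

Lemma zpt_eq z : 0 < z.2 -> (forall w, 0 < w.2 -> Rfun n F z <= Rfun n F w) ->
  zpt n F = z.
Proof.
move=> z0 zmin; have [p0 pmin] := zptP; apply/eqP; apply: contraT; rewrite eq_sym => zp.
by have := pmin z z0 zp; rewrite ltNge zmin.
Qed.

Lemma theta_gt0 : 0 < theta n F.
Proof. by rewrite Rfun_gt0 //; have [] := zptP. Qed.

End StableForm.

Lemma F0P F : split_form F -> stable n F ->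
  exists g, [/\ \det g = 1, F0 n F = form_act F g & zpt n F = hact g (jpt R)].
Proof.
move=> sF st; have j0 : 0 < (jpt R).2 by exact: ltr01.
(* Equivariance of the minimum point, by its uniqueness. It shows that the set from which [F0] is
   picked is nonempty, and locates [zpt n F] once [F0] is known. *)
have zact g : \det g = 1 -> hact g (zpt n (form_act F g)) = zpt n F.
  move=> dg; have [p0 pmin] := zptP (split_form_act sF dg) (stable_act sF dg st).
  apply/esym/zpt_eq => // [|w w0]; first exact: hact_gt0.
  rewrite -Rfun_act // -[w](hactVK dg) // -Rfun_act ?hact_gt0 ?det_invmx1 //.
  set u := hact _ w; have [->//|ne] := eqVneq u (zpt n (form_act F g)).
  by rewrite ltW // pmin // hact_gt0 ?det_invmx1.
pose S : set (bform R) := [set G : bform R |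
    (exists2 g : 'M[C]_2, \det g = 1 & G = form_act F g) /\ zpt n G = jpt R]%classic.
have ex : exists G, S G.
  have [z0 _] := zptP sF st; have [g dg gz] := hact_transitive z0.
  exists (form_act F g); split; first by exists g.
  rewrite -[LHS](hactK dg) ?zact // -?gz ?hactK //.
  by have [] := zptP (split_form_act sF dg) (stable_act sF dg st).
have [[g dg e] zj] : S (F0 n F) := xgetPex F ex.
by exists g; split => //; rewrite -zj e zact.
Qed.

End MinimumPoint.

(** * Hyperbolic cosine, minima of sets, distance to [j] *)

Section HyperbolicCosine.
Variable R : realType.
Implicit Types (x d h : R) (A : set R).

Lemma cosh_ge1 d : 1 <= cosh d.
Proof.
rewrite /cosh expRN; have e0 := expR_gt0 d; set e := expR d in e0 *.
rewrite -subr_ge0 (_ : _ - _ = (e - 1) ^+ 2 / (2 * e)).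
  by rewrite divr_ge0 ?sqr_ge0 // mulr_ge0 // ltW.
by field; rewrite gt_eqF.
Qed.

Lemma arcosh_cosh d : 0 <= d -> arcosh (cosh d) = d.
Proof.
move=> d0; rewrite /arcosh /cosh expRN; have e0 := expR_gt0 d.
have e1 : 1 <= expR d by rewrite -expR0 ler_expR.
rewrite -[RHS]expRK; congr ln; set e := expR d in e0 e1 *.
rewrite (_ : _ - 1 = ((e - e^-1) / 2) ^+ 2); last by field; rewrite gt_eqF.
have ei : e^-1 <= 1 by rewrite invf_le1.
by rewrite sqrtr_sqr ger0_norm; [field; rewrite gt_eqF|lra].
Qed.

Lemma cosh_arcosh h : 1 <= h -> cosh (arcosh h) = h.
Proof.
move=> h1; rewrite /cosh /arcosh expRN.
have s2 : Num.sqrt (h ^+ 2 - 1) ^+ 2 = h ^+ 2 - 1 by rewrite sqr_sqrtr; nra.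
have s0 := sqrtr_ge0 (h ^+ 2 - 1); set s := Num.sqrt _ in s0 s2 *.
have y0 : 0 < h + s by lra.
rewrite lnK ?posrE // (_ : (h + s)^-1 = h - s); first by field.
by apply: (mulfI (lt0r_neq0 y0)); rewrite divff ?lt0r_neq0 //; lra.
Qed.

Lemma arcosh_ge0 h : 1 <= h -> 0 <= arcosh h.
Proof. by move=> h1; rewrite ln_ge0 // (le_trans h1) // lerDl sqrtr_ge0. Qed.

Lemma minset_unique A m : A m -> lbound A m -> Defs.minset A = m.
Proof.
move=> Am lbm; apply: xget_unique => // y [Ay lby].
by apply/eqP; rewrite eq_le lbm // lby.
Qed.

(* [minset] takes the default value [0] on a set without minimum. *)
Lemma minset_lbound A : Defs.minset A != 0 -> lbound A (Defs.minset A).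
Proof. by rewrite /Defs.minset; case: xgetP => [y _ []//|_ /eqP]. Qed.

(** For [0 <= m] the default value [0] obeys the bound as well, so attainment of the minimum need
    not be established first. *)
Lemma minset_le A m : A m -> 0 <= m -> Defs.minset A <= m.
Proof. by rewrite /Defs.minset; case: xgetP => [y _ [_ lby] Am _|_ _]; [exact: lby|]. Qed.

Lemma hdist_j (z : R[i] * R) : 0 < z.2 -> hdist z (jpt R) = arcosh (height (vec_of z)).
Proof. by move=> z0; rewrite height_vec_of // /hdist /= subr0 expr1n mulr1. Qed.

End HyperbolicCosine.

(** * The norm along the orbit *)

Section Comparison.
Variables (R : realType) (n : nat) (F : bform R).
Hypotheses (n_gt0 : (0 < n)%N) (sF : split_form n F) (st : stable n F).
Local Notation C := R[i].
Local Notation vec := (R * R * R)%type.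
Implicit Types (z : C * R) (x : vec) (g : 'M[C]_2).

Lemma Rfun_j_fnorm G : split_form n G ->
  Rfun n G (jpt R) <= 2 ^+ n.-1 * fnorm G /\
  fnorm G <= (2 ^+ n)^-1 * ('C(n.*2, n))%:R * Rfun n G (jpt R).
Proof.
move=> sG; have -> : Rfun n G (jpt R) =
    \prod_k (cabs (factors n G k).1 ^+ 2 + cabs (factors n G k).2 ^+ 2).
  by rewrite Rfun_hform; apply: eq_bigr => k _; exact: hform_j.
have [_ e] := sG; have lo := fnorm_ge (factors n G) n_gt0.
by have up := fnorm_le (factors n G) n_gt0; rewrite -e in lo up.
Qed.

Let G := F0 n F.
Let p := prodH (@root_dir R n G).

Lemma split_F0 : split_form n G.
Proof. by have [g [dg e _]] := F0P n_gt0 sF st; rewrite /G e; exact: split_form_act. Qed.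

Lemma stable_F0 : stable n G.
Proof. by have [g [dg e _]] := F0P n_gt0 sF st; rewrite /G e; exact: stable_act. Qed.

Let unit_dir k := dot3_root_dir split_F0 k.

Lemma theta_F0 : theta n F = Rfun n G (jpt R).
Proof.
have [g [dg e zE]] := F0P n_gt0 sF st.
by rewrite /theta zE /G e Rfun_act //; exact: ltr01.
Qed.

Lemma F0_ratio z : 0 < z.2 -> Rfun n G z / Rfun n G (jpt R) = p (vec_of z).
Proof.
move=> z0; have E0 := prod_weight_gt0 split_F0.
rewrite !(Rfun_prodH split_F0) ?ltr01 // vec_of_j prodH0 mulr1.
by rewrite mulrAC divff ?mul1r ?gt_eqF.
Qed.

Lemma prodH_F0_ge1 x : 1 <= p x.
Proof.
have [g [dg e zE]] := F0P n_gt0 sF st.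
apply: (Rfun_j_min_prodH split_F0) => w w0.
rewrite -theta_F0 /G e Rfun_act // /theta.
have [z0 zmin] := zptP n_gt0 sF st.
have [->//|ne] := eqVneq (hact g w) (zpt n F).
by rewrite ltW // zmin // hact_gt0.
Qed.

Lemma prodH_F0_gt1 x : x != (0, 0, 0) -> 1 < p x.
Proof.
apply: prodH_ge1_unique => //; [exact: stable_root_dir split_F0 stable_F0|].
exact: prodH_F0_ge1.
Qed.

(* [F . g] evaluated at [j] is [F0] evaluated at a point whose distance to [j] is that
   of [g^-1 z(F)]. *)
Lemma Rfun_orbit_j g : \det g = 1 -> exists z, [/\ 0 < z.2,
  Rfun n (form_act F g) (jpt R) = theta n F * p (vec_of z) &
  height (vec_of z) = height (vec_of (hact (invmx g) (zpt n F)))].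
Proof.
move=> dg; have [h [dh e zE]] := F0P n_gt0 sF st.
have j0 : 0 < (jpt R).2 by exact: ltr01.
(* Since [z(F) = h j], one has [g j = h (k j)] and [g^-1 z(F) = k^-1 j]; [hact_invmx_j] compares the
   heights of [k j] and [k^-1 j]. *)
pose k := invmx h *m g.
have dk : \det k = 1 by rewrite det_mulmx det_invmx1 // mul1r.
have z0 : 0 < (hact k (jpt R)).2 by rewrite hact_gt0.
exists (hact k (jpt R)); split => //.
  rewrite -F0_ratio // -theta_F0 mulrC divfK ?gt_eqF ?theta_gt0 //.
  have e3 : hact h (hact k (jpt R)) = hact g (jpt R).
    by rewrite -(hact_mul dh dk j0) /k mulmxA (mulmxV1 dh) mul1mx.
  have e2 : Rfun n G (hact k (jpt R)) = Rfun n F (hact h (hact k (jpt R))).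
    by rewrite /G e; exact: (Rfun_act sF dh z0).
  exact: (etrans (Rfun_act sF dg j0) (etrans (congr1 (Rfun n F) (esym e3)) (esym e2))).
rewrite zE -hact_mul ?det_invmx1 //.
have k1 : invmx g *m h *m k = 1%:M.
  by rewrite /k -mulmxA (mulmxA h) (mulmxV1 dh) mul1mx mulVmx1.
have -> : invmx g *m h = invmx k.
  by rewrite -[LHS]mulmx1 -(mulmxV1 dk) mulmxA k1 mul1mx.
by rewrite !height_hform ?hact_gt0 ?det_invmx1 // hact_invmx_j.
Qed.

Lemma epsfunE d : epsfun n F d =
  Defs.minset [set p (vec_of z) | z in [set z | H3 z /\ hdist z (jpt R) = d]]%classic.
Proof.
rewrite /epsfun; congr Defs.minset; apply/seteqP.
by split=> _ [z [z0 zd] <-]; exists z => //; rewrite F0_ratio.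
Qed.

Lemma fnorm_orbit_lower g z : \det g = 1 ->
  Rfun n (form_act F g) (jpt R) = theta n F * p (vec_of z) ->
  theta n F * p (vec_of z) <= 2 ^+ n.-1 * fnorm (form_act F g).
Proof.
by move=> dg <-; have [] := Rfun_j_fnorm (split_form_act sF dg).
Qed.

Let form_act1 : form_act F 1%:M = F.
Proof.
by rewrite (form_act_split sF) [RHS](sF.2); apply: eq_bigr => k _; rewrite pair_act1.
Qed.

Lemma Rfun_j_F : exists z, [/\ 0 < z.2,
  Rfun n F (jpt R) = theta n F * p (vec_of z) &
  height (vec_of z) = height (vec_of (zpt n F))].
Proof.
have [z] := Rfun_orbit_j (det1 _ _); rewrite form_act1 invmx1 hact1; first by exists z.
by have [] := zptP n_gt0 sF st.
Qed.

Lemma fnorm_theta_lower :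
  (2 ^+ n.-1)^-1 * epsfun n F (hdist (zpt n F) (jpt R)) <= fnorm F / theta n F.
Proof.
have t0 := theta_gt0 n_gt0 sF st; have [zz0 _] := zptP n_gt0 sF st.
have [z [z0 e hz]] := Rfun_j_F.
rewrite ler_pdivrMl ?exprn_gt0 // mulrA ler_pdivlMr //.
have [lo _] := Rfun_j_fnorm sF; apply: le_trans lo; rewrite e mulrC ler_pM2l // epsfunE.
apply: minset_le; last by rewrite (le_trans ler01) ?prodH_F0_ge1.
by exists z => //; split => //; rewrite !hdist_j // hz.
Qed.

Lemma fnorm_theta_upper :
  fnorm F / theta n F <=
  (2 ^+ n)^-1 * ('C(n.*2, n))%:R * cosh (hdist (zpt n F) (jpt R)) ^+ n.
Proof.
have t0 := theta_gt0 n_gt0 sF st; have [zz0 _] := zptP n_gt0 sF st.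
have [z [z0 e hz]] := Rfun_j_F.
rewrite hdist_j // cosh_arcosh ?height_ge1 // -hz ler_pdivrMr //.
have [_ up] := Rfun_j_fnorm sF; apply: le_trans up _; rewrite -[leRHS]mulrA.
rewrite ler_wpM2l ?mulr_ge0 ?invr_ge0 ?exprn_ge0 // e mulrC ler_pM2r //.
exact: prodH_le_height prodH_F0_ge1 _.
Qed.

(** Places the argument of [epsfun_inv] in the range of [epsfun]. *)
Lemma fnorm_theta_ge1 : 1 <= 2 ^+ n.-1 * (fnorm F / theta n F).
Proof.
have t0 := theta_gt0 n_gt0 sF st; have [z [z0 e hz]] := Rfun_j_F.
rewrite mulrA ler_pdivlMr // mul1r; have [lo _] := Rfun_j_fnorm sF.
by apply: le_trans lo; rewrite e ler_pMr // prodH_F0_ge1.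
Qed.

(** The sphere given by [prodH_sphere_min] has minimum exactly [v]; this bypasses the continuity of
    [epsfun]. *)
Lemma epsfun_surj v : 1 <= v -> exists2 d, 0 <= d & epsfun n F d = v.
Proof.
move=> v1.
have [s [s0 [u u1 pu] lo]] :=
  prodH_sphere_min unit_dir (stable_root_dir split_F0 stable_F0) n_gt0 v1.
exists (arcosh (height (scale3 s u))); first exact: arcosh_ge0 (height_ge1 _).
rewrite epsfunE; apply: minset_unique.
  exists (point_of (scale3 s u)); last by rewrite vec_ofK.
  by split; [exact: point_of_gt0|rewrite hdist_j ?vec_ofK ?point_of_gt0].
move=> _ [z [z0 zd] <-]; move: zd; rewrite hdist_j // => /(congr1 (@cosh R)).
rewrite !cosh_arcosh ?height_ge1 // => /(congr1 (fun t => t ^+ 2)).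
rewrite !height_sqr dot3_scale u1 mulr1 => /addrI zs.
have [w w1 ->] := scale3_unit (vec_of z).
by rewrite zs sqrtr_sqr ger0_norm //; exact: lo.
Qed.

Lemma epsfun_invP v : 1 <= v ->
  0 <= epsfun_inv n F v /\ epsfun n F (epsfun_inv n F v) = v.
Proof.
move=> v1.
have sj : set_surj [set d : R | 0 <= d]%classic [set v]%classic (epsfun n F).
  by move=> _ ->; have [d d0 <-] := epsfun_surj v1; exists d.
split; last exact: (surjpK (fun=> 0) sj (mem_set erefl)).
by apply: (@surjpinv_image_sub _ _ (fun=> 0) _ _ _ sj); exists v.
Qed.

(** Shrink [x] along its ray to the sphere of radius [d]. There [p] is at least [epsfun n F d = v],
    a genuine minimum because [v] is nonzero, and [p] strictly increases on the way back to [x]. *)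
Lemma epsfun_lt v x : 1 <= v -> cosh (epsfun_inv n F v) < height x -> v < p x.
Proof.
move=> v1; have [d0 dv] := epsfun_invP v1; set d := epsfun_inv n F v in d0 dv *.
move=> dx; have c1 := cosh_ge1 d; have hs := height_sqr x.
have x0 : 0 < dot3 x x by nra.
(* [c] is [sinh d / |x|], which puts [c x] at distance [d] from the origin. *)
pose c := Num.sqrt ((cosh d ^+ 2 - 1) / dot3 x x).
have c2 : c ^+ 2 = (cosh d ^+ 2 - 1) / dot3 x x.
  by rewrite sqr_sqrtr // divr_ge0 ?(ltW x0) //; nra.
have c01 : 0 <= c < 1.
  rewrite sqrtr_ge0 /= -(ltr_pXn2r (n := 2)) ?nnegrE ?sqrtr_ge0 // c2 expr1n.
  by rewrite ltr_pdivrMr // mul1r; nra.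
have hy : height (scale3 c x) = cosh d.
  apply: height_eq; first by lra.
  by rewrite dot3_scale c2 divfK ?gt_eqF //; ring.
apply: (@le_lt_trans _ _ (p (scale3 c x))).
  rewrite -{1}dv epsfunE; apply: minset_lbound.
    by rewrite -epsfunE dv gt_eqF // (lt_le_trans ltr01).
  exists (point_of (scale3 c x)); last by rewrite vec_ofK.
  split; first exact: point_of_gt0.
  by rewrite hdist_j ?vec_ofK ?point_of_gt0 // hy arcosh_cosh.
apply: prodH_scale_lt => //; first exact: prodH_F0_gt1.
by apply: contraTneq x0 => ->; rewrite /dot3 /= !mul0r !addr0 ltxx.
Qed.

Lemma fnorm_orbit_gt g : \det g = 1 ->
  cosh (epsfun_inv n F (2 ^+ n.-1 * (fnorm F / theta n F))) <
    height (vec_of (hact (invmx g) (zpt n F))) ->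
  fnorm F < fnorm (form_act F g).
Proof.
move=> dg; have [z [z0 e <-]] := Rfun_orbit_j dg => /(epsfun_lt fnorm_theta_ge1).
have t0 := theta_gt0 n_gt0 sF st.
rewrite mulrA ltr_pdivrMr // [ltRHS]mulrC => lt.
by have := lt_le_trans lt (fnorm_orbit_lower dg e); rewrite ltr_pM2l ?exprn_gt0.
Qed.

Lemma squarefree_root_dir : squarefree F -> injective (@root_dir R n G).
Proof.
move=> sqF k l e; apply/eqP; apply: contraT => kl.
have [g [dg GE _]] := F0P n_gt0 sF st.
have par : forall i, i \in [set k; l]%SET ->
    proportional (factors n G k) (factors n G i).
  move=> i; rewrite !inE => /orP[] /eqP ->; apply: direction_eq => //;
  exact: factors_neq0 split_F0 _.
have := fdvd_parallel split_F0 par; rewrite cards2 kl [X in fdvd _ X]GE.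
move=> /(fdvd_act sF dg); rewrite form_actX form_act_lin => /sqF.
(* A linear form vanishes at its own pair, hence is not a unit. *)
set v := pair_act _ _ => /mulrV /(congr1 (meval (fun i => if i == 0 then v.1 else v.2))).
rewrite mevalM meval1 /lin /linform mevalB !mevalZ !mevalXU /=.
by rewrite [v.2 * _]mulrC subrr mul0r => /eqP; rewrite eq_sym oner_eq0.
Qed.

Definition vec_of_pair (q : C * R) : vec := (complex.Re q.1, complex.Im q.1, q.2).

Lemma dotE (q r : C * R) : dot q r = dot3 (vec_of_pair q) (vec_of_pair r).
Proof.
case: q r => -[q1 q2] q3 [[r1 r2] r3];
by rewrite /dot /dot3 /=; ring.
Qed.

Lemma vec_of_pair_sphpt (v : C * C) : v != (0, 0) ->
  vec_of_pair (sphpt v.1 v.2) = direction v.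
Proof.
move=> v0; have N0 := weight_gt0 v0; rewrite /sphpt /direction.
have ReC (r : R) (x : C) : complex.Re ((real_complex R r) * x) = r * complex.Re x.
  by case: x => a b /=; ring.
have ImC (r : R) (x : C) : complex.Im ((real_complex R r) * x) = r * complex.Im x.
  by case: x => a b /=; ring.
case: eqP => [v2|/eqP v2].
  move: N0; rewrite /weight v2 cabs0 expr0n addr0 subr0 /= => N0.
  by rewrite rmorph0 mulr0 /vec_of_pair /= !mulr0 !mul0r divff ?gt_eqF.
have b0 : 0 < cabs v.2 ^+ 2 by rewrite lt_neqAle sqr_ge0 eq_sym sqrf_eq0 cabs_eq0 v2.
have qE : cabs (v.1 / v.2) ^+ 2 = cabs v.1 ^+ 2 / cabs v.2 ^+ 2.
  apply: (mulIf (lt0r_neq0 b0)); rewrite divfK ?gt_eqF // -exprMn -cabsM.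
  by rewrite divfK.
have q1 : cabs (v.1 / v.2) ^+ 2 + 1 = weight v / cabs v.2 ^+ 2.
  by rewrite qE /weight; field; rewrite cabs_eq0.
have NC : real_complex R (weight v) != 0 by rewrite fmorph_eq0 gt_eqF.
have v2J : Num.conj v.2 != 0 by rewrite -cabs_eq0 cabsJ cabs_eq0.
rewrite /vec_of_pair /= q1.
have -> : 2 * (v.1 / v.2) / real_complex R (weight v / cabs v.2 ^+ 2) =
    real_complex R (2 / weight v) * (v.1 * Num.conj v.2).
  rewrite fmorph_div /= cabs_sqrC (fmorph_div (real_complex R) 2) rmorph_nat /=.
  by field; rewrite NC v2J v2.
rewrite ReC ImC; congr (_, _, _); try ring.
by rewrite qE /weight; field; rewrite cabs_eq0 v2; have := lt0r_neq0 N0; rewrite /weight => ->.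
Qed.

Let eps_values : set R :=
  [set (\prod_(k < n) (1 + dot q (sphpt (factors n G k).1 (factors n G k).2) * r))
    / (1 - r ^+ 2) | q in @S2 R & r in [set r : R | 0 <= r < 1]]%classic.

Lemma eps_values_lbound : squarefree F -> exists2 c, 0 < c & lbound eps_values c.
Proof.
move=> sqF; have [c c0 lo] := sphere_prod_lbound unit_dir (squarefree_root_dir sqF).
exists c => // _ [q q1 [r /= r01 <-]].
have qq : dot3 (vec_of_pair q) (vec_of_pair q) = 1.
  by move: q1; rewrite /S2 /= cabs_sqr /dot3 /= => <-; ring.
rewrite (eq_bigr (fun k => 1 + dot3 (vec_of_pair q) (root_dir G k) * r)); first exact: lo.
by move=> k _; rewrite dotE vec_of_pair_sphpt // factors_neq0 //; exact: split_F0.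
Qed.

Lemma eps_gt0 : squarefree F -> 0 < eps n F.
Proof.
move=> /eps_values_lbound[c c0 lo].
apply: lt_le_trans c0 _; apply: lb_le_inf => //; eexists; exists (0, 1).
  by rewrite /S2 /= cabs0 expr0n expr1n add0r.
by exists 0 => //=; rewrite lexx ltr01.
Qed.

(** Take [phi = - x / |x|] and [rho = |x| / height x] in the infimum. Each factor of [p x] is then
    [height x * (1 + <phi, phi_k> rho)], and [1 - rho^2] is [1 / height x ^ 2], which removes two
    powers of the height. *)
Lemma eps_le x : squarefree F -> (2 <= n)%N -> eps n F * height x ^+ (n - 2) <= p x.
Proof.
move=> sqF n2; have h0 := height_gt0 x; have hs := height_sqr x.
have [u u1 xu] := scale3_unit x; set s := Num.sqrt _ in xu.
have s0 : 0 <= s := sqrtr_ge0 _.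
have s2 : s ^+ 2 = dot3 x x by rewrite sqr_sqrtr // dot3_ge0.
pose q : C * R := (Complex (- u.1.1) (- u.1.2), - u.2).
have qd (y : vec) : dot3 (vec_of_pair q) y * s = - dot3 y x.
  by rewrite xu /dot3 /=; ring.
pose r := s / height x.
have r01 : 0 <= r < 1.
  rewrite divr_ge0 ?(ltW h0) //= ltr_pdivrMr // mul1r.
  by rewrite -(ltr_pXn2r (n := 2)) ?nnegrE ?(ltW h0) // s2 hs; lra.
have r2 : 1 - r ^+ 2 = (height x ^+ 2)^-1.
  rewrite /r expr_div_n s2 (_ : dot3 x x = height x ^+ 2 - 1); last by rewrite hs; ring.
  by field; rewrite gt_eqF.
have -> : p x = (\prod_(k < n) (1 + dot q (sphpt (factors n G k).1 (factors n G k).2) * r))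
    / (1 - r ^+ 2) * height x ^+ (n - 2).
  rewrite r2 invrK -mulrA -exprD subnKC // -[X in height x ^+ X](card_ord n) -prodr_const.
  rewrite -big_split; apply: eq_bigr => k _ /=.
  rewrite dotE vec_of_pair_sphpt ?factors_neq0 //; last exact: split_F0.
  rewrite mulrDl mul1r /r mulrA qd mulfVK ?gt_eqF //.
rewrite ler_wpM2r ?exprn_ge0 ?(ltW h0) //; apply: ge_inf.
  by have [c _ lo] := eps_values_lbound sqF; exists c.
exists q; last by exists r.
by rewrite /S2 /= cabs_sqr /= -u1 /dot3; ring.
Qed.

Lemma fnorm_orbit_gt_squarefree g : (3 <= n)%N -> squarefree F -> \det g = 1 ->
  2 * (2 * fnorm F / (eps n F * theta n F)) `^ ((n - 2)%:R^-1) <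
    height (vec_of (hact (invmx g) (zpt n F))) ->
  fnorm F < fnorm (form_act F g).
Proof.
move=> n3 sqF dg; have [z [z0 e <-]] := Rfun_orbit_j dg.
have t0 := theta_gt0 n_gt0 sF st; have e0 := eps_gt0 sqF.
set A := _ / _ => lt.
have A0 : 0 <= A by rewrite divr_ge0 ?mulr_ge0 ?fnorm_ge0 // ltW.
have m0 : (0 < n - 2)%N by rewrite subn_gt0.
have AE : (A `^ (n - 2)%:R^-1) ^+ (n - 2) = A.
  rewrite -powR_mulrn ?powR_ge0 // -powRrM mulVf ?powRr1 //.
  by rewrite pnatr_eq0 -lt0n.
have hp : (2 * A `^ (n - 2)%:R^-1) ^+ (n - 2) < height (vec_of z) ^+ (n - 2).
  by rewrite ltr_pXn2r ?nnegrE ?mulr_ge0 ?powR_ge0 // ltW // height_gt0.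
rewrite exprMn AE in hp.
have lo : theta n F * (eps n F * (2 ^+ (n - 2) * A)) < 2 ^+ n.-1 * fnorm (form_act F g).
  apply: lt_le_trans (fnorm_orbit_lower dg e); rewrite ltr_pM2l //.
  apply: lt_le_trans (eps_le _ sqF (ltnW n3)); by rewrite ltr_pM2l.
have n1 : n.-1 = (n - 2).+1 by lia.
(* The 2 outside the root contributes [2 ^ (n - 2)] and the 2 inside the missing one, matching the
   constant of the lower bound for the norm. *)
have E : theta n F * (eps n F * (2 ^+ (n - 2) * A)) = 2 ^+ n.-1 * fnorm F.
  by rewrite n1 exprS /A; field; rewrite !gt_eqF.
by move: lo; rewrite E ltr_pM2l ?exprn_gt0.
Qed.

End Comparison.

Theorem theorem4p7 (R : realType) (n : nat) (F : bform R)
    (hn : (3 <= n)%N) (hF : F \is n.-homog) (hst : stable n F) :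
  (let delta := hdist (zpt n F) (jpt R) in
   (2 ^+ n.-1)^-1 * epsfun n F delta <= fnorm F / theta n F
   /\ fnorm F / theta n F <= (2 ^+ n)^-1 * ('C(n.*2, n))%:R * cosh delta ^+ n)
  /\
  (forall (g : 'M[R[i]]_2) (t : R[i]) (u : R),
     \det g = 1 -> hact (invmx g) (zpt n F) = (t, u) ->
     (((cabs t ^+ 2 + u ^+ 2 + 1) / (2 * u) >
         cosh (epsfun_inv n F (2 ^+ n.-1 * (fnorm F / theta n F)))) ->
      fnorm (form_act F g) > fnorm F)
     /\
     (squarefree F ->
      ((cabs t ^+ 2 + u ^+ 2 + 1) / (2 * u) >
         2 * (2 * fnorm F / (eps n F * theta n F)) `^ ((n - 2)%:R^-1)) ->
      fnorm (form_act F g) > fnorm F)).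
Proof.
have n0 : (0 < n)%N by exact: leq_ltn_trans hn.
have sF := split_form_stable n0 hF hst.
split=> [|g t u dg gz].
  by split; [exact: fnorm_theta_lower|exact: fnorm_theta_upper].
have u0 : 0 < (hact (invmx g) (zpt n F)).2.
  by rewrite hact_gt0 ?det_invmx1 //; have [] := zptP n0 sF hst.
have hE := height_vec_of u0; rewrite gz /= in hE; rewrite -hE -gz.
split=> [|sqF]; first exact: fnorm_orbit_gt.
exact: fnorm_orbit_gt_squarefree.
Qed.
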